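(* Let $n\geq 1$, let $\lambda_1,\ldots,\lambda_n,C\in\mathbb{R}\setminus\{0\}$ and $\alpha\in\mathbb{R}$ be constants, let $I$ be an open interval in $\mathbb{R}$, and let $\theta:I\to\mathbb{R}$ or $\theta:I\to\mathbb{R}/2\pi\mathbb{Z}$ and $w_1,\ldots,w_n:I\to\mathbb{C}\setminus\{0\}$ be smooth functions. Suppose that $$\frac{dw_j}{ds}=\lambda_j e^{i\theta(s)}\,\overline{w_1\cdots w_{j-1}w_{j+1}\cdots w_n},\quad j=1,\ldots,n,\qquad \frac{d\theta}{ds}=\alpha\,\mathrm{Im}\bigl(e^{-i\theta(s)}w_1\cdots w_n\bigr)$$ hold in $I$. Then the submanifold $$L=\Bigl\{\bigl(x_1w_1(s),\ldots,x_nw_n(s)\bigr): s\in I,\ x_j\in\mathbb{R},\ \sum_{j=1}^n\lambda_jx_j^2=C\Bigr\}$$ of $\mathbb{C}^n$ is Lagrangian, with Lagrangian angle $\theta(s)$ at $(x_1w_1(s),\ldots,x_nw_n(s))$, and its position vector $F$ and mean curvature vector $H$ satisfy $\alpha F^\perp=CH$. That is, $L$ is a self-expander when $\alpha/C>0$ and a self-shrinker when $\alpha/C<0$. When $\alpha=0$ the Lagrangian angle $\theta$ is constant, so that $L$ is special Lagrangian, with $H=0$.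
   Context: $\mathbb{C}^n$ has coordinates $z_j=x_j+iy_j$, the Euclidean metric, the symplectic form $\omega=\sum_j dx_j\wedge dy_j$, and complex structure $J$ (multiplication by $i$). An $n$-dimensional (immersed) submanifold $L$ of $\mathbb{C}^n$ is Lagrangian if $\omega|_L=0$. The Lagrangian angle $\theta:L\to\mathbb{R}$ or $\mathbb{R}/2\pi\mathbb{Z}$ of an oriented Lagrangian $L$ is defined by $dz_1\wedge\cdots\wedge dz_n|_L=e^{i\theta}\mathrm{vol}_L$ (here for a suitable orientation of $L$). $L$ is special Lagrangian if $\theta$ is constant. $H$ is the mean curvature vector (trace of the second fundamental form), $F$ the position vector, $F^\perp$ its projection to the normal bundle. A submanifold is self-similar if $H\equiv cF^\perp$ for some constant $c\in\mathbb{R}$; it is a self-expander if $c>0$ and a self-shrinker if $c<0$. Here $L$ is understood as an immersed submanifold via the map $\bigl((x_1,\ldots,x_n),s\bigr)\mapsto(x_1w_1(s),\ldots,x_nw_n(s))$ from $\{x\in\mathbb{R}^n:\sum_j\lambda_jx_j^2=C\}\times I$. Empty products are $1$. *)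

(* Defs.v *)
(* C^n is 'rV[R[i]]_n, with R[i] the complex numbers over R : realType. *)
From HB Require Import structures.
From mathcomp Require Import all_boot all_order all_algebra generic_quotient.
From mathcomp Require Import all_classical all_reals all_analysis.
From mathcomp Require Import complex.

Set Implicit Arguments.
Unset Strict Implicit.
Unset Printing Implicit Defensive.

Import Order.TTheory GRing.Theory Num.Theory.
Import numFieldNormedType.Exports.

Local Open Scope classical_set_scope.
Local Open Scope ring_scope.
Local Open Scope complex_scope.
Local Open Scope quotient_scope.

Section Smoothness.
Context {R : realType} {E : normedModType R}.
Implicit Types (A : set E) (f : E -> R).

Fixpoint Ck_on A (k : nat) f : Prop :=
  if k is k'.+1 then
    (forall p, A p -> differentiable f p) /\
    (forall v : E, Ck_on A k' (fun p => 'D_v f p))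
  else forall p, A p -> {for p, continuous f}.

Definition smooth_on A f : Prop := forall k, Ck_on A k f.

(* A complex-valued map is handled through its real and imaginary parts. *)
Definition csmooth_on A (f : E -> R[i]) : Prop :=
  smooth_on A (fun p => complex.Re (f p)) /\
  smooth_on A (fun p => complex.Im (f p)).

Definition cderive (f : E -> R[i]) (p v : E) : R[i] :=
  'D_v (fun q => complex.Re (f q)) p +i* 'D_v (fun q => complex.Im (f q)) p.

Definition vderive n (F : E -> 'rV[R[i]]_n) (p v : E) : 'rV[R[i]]_n :=
  \row_j cderive (fun q => F q 0 j) p v.

End Smoothness.

Section Angles.
Context {R : realType}.

Definition eqmod2pi (a b : R) : bool :=
  `[< exists m : int, a - b = m%:~R * (2 * pi) >].

Lemma eqmod2pi_refl : reflexive eqmod2pi.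
Proof. by move=> a; apply/asboolP; exists 0; rewrite subrr mul0r. Qed.

Lemma eqmod2pi_sym : symmetric eqmod2pi.
Proof.
suff h a b : eqmod2pi a b -> eqmod2pi b a by move=> a b; apply/idP/idP; exact: h.
by move=> /asboolP[m hm]; apply/asboolP; exists (- m); rewrite mulrNz mulNr -hm opprB.
Qed.

Lemma eqmod2pi_trans : transitive eqmod2pi.
Proof.
move=> b a c /asboolP[m hm] /asboolP[k hk]; apply/asboolP; exists (m + k).
by rewrite mulrzDr mulrDl -hm -hk addrA subrK.
Qed.

Canonical eqmod2pi_equiv :=
  EquivRel eqmod2pi eqmod2pi_refl eqmod2pi_sym eqmod2pi_trans.

End Angles.

(* The two kinds of angle functions allowed: R-valued and R/2piZ-valued. *)
Variant angle_kind := RealAngle | AngleMod2pi.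

Definition angle (R : realType) (k : angle_kind) : Type :=
  match k with
  | RealAngle => R
  | AngleMod2pi => {eq_quot (@eqmod2pi R)}
  end.

Definition angle_pi {R : realType} (k : angle_kind) : R -> angle R k :=
  match k return R -> angle R k with
  | RealAngle => id
  | AngleMod2pi => fun t => (\pi_({eq_quot (@eqmod2pi R)}) t)%qT
  end.

Definition angle_repr {R : realType} (k : angle_kind) : angle R k -> R :=
  match k return angle R k -> R with
  | RealAngle => id
  | AngleMod2pi => fun t => repr t
  end.

Definition expi {R : realType} {k : angle_kind} (t : angle R k) : R[i] :=
  cos (angle_repr t) +i* sin (angle_repr t).

Section AngleFacts.
Context {R : realType}.

Lemma angle_reprK (k : angle_kind) (t : angle R k) :
  angle_pi k (angle_repr t) = t.
Proof. by case: k t => //= t; rewrite reprK. Qed.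

Lemma cos_sin_eqmod2pi (a b : R) : eqmod2pi a b -> cos a = cos b /\ sin a = sin b.
Proof.
move=> /asboolP[m] /eqP; rewrite subr_eq addrC => /eqP ->.
have per (j : nat) (x : R) :
    cos (x + j%:R * (2 * pi)) = cos x /\ sin (x + j%:R * (2 * pi)) = sin x.
  elim: j => [|j [IHc IHs]]; first by rewrite mul0r addr0.
  have -> : x + j.+1%:R * (2 * pi) = x + j%:R * (2 * pi) + pi *+ 2.
    by rewrite -natr1 mulrDl mul1r addrA [2 * pi]mulr_natl.
  by rewrite cosD2pi sinD2pi.
case: m => j; first by rewrite -pmulrn; exact: per.
have := per j.+1 (b + (Negz j)%:~R * (2 * pi)).
by rewrite NegzE mulrNz -pmulrn mulNr subrK => -[-> ->].
Qed.

Lemma expi_angle_pi (k : angle_kind) (t : R) :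
  expi (angle_pi k t) = cos t +i* sin t.
Proof.
case: k => //=; rewrite /expi /=.
have h : eqmod2pi (repr (\pi_({eq_quot (@eqmod2pi R)}) t)%qT) t.
  by apply/eqquotP; exact: reprK.
by have [-> ->] := cos_sin_eqmod2pi h.
Qed.

(* Near each point, an angle function is the class of a real function (a lift);
   smoothness and the derivative are those of the lift. *)
Definition smooth_angle_on {k} (A : set R) (theta : R -> angle R k) : Prop :=
  forall s, A s -> exists (U : set R) (lift : R -> R),
    [/\ open U, U s, smooth_on U lift
      & forall t, U t -> theta t = angle_pi k (lift t)].

Definition is_angle_derive {k} (theta : R -> angle R k) (s d : R) : Prop :=
  exists lift : R -> R,
    (\forall t \near s, theta t = angle_pi k (lift t)) /\ is_derive s 1 lift d.

End AngleFacts.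

Section Euclidean.
Context {R : realType} {n : nat}.
Implicit Types z y : 'rV[R[i]]_n.

Definition euclid z y : R :=
  \sum_j (complex.Re (z 0 j) * complex.Re (y 0 j) +
          complex.Im (z 0 j) * complex.Im (y 0 j)).

Definition omega z y : R :=
  \sum_j (complex.Re (z 0 j) * complex.Im (y 0 j) -
          complex.Im (z 0 j) * complex.Re (y 0 j)).

(* (dz_1 /\ ... /\ dz_n)(b_1, ..., b_n) *)
Definition dz (b : 'I_n -> 'rV[R[i]]_n) : R[i] := \det (\matrix_(i, j) b i 0 j).

End Euclidean.

(* An immersed n-dimensional submanifold of C^n, given as the image under [pos]
   of the level set [eqn = 0] in the open set [dom] of R^n x R. *)
Record submanifold (R : realType) (n : nat) := Submanifold {
  dom : set ('rV[R]_n * R)%type ;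
  eqn : 'rV[R]_n * R -> R ;
  pos : 'rV[R]_n * R -> 'rV[R[i]]_n
}.

Section Submanifold.
Context {R : realType} {n : nat} (L : submanifold R n).
Local Notation E := ('rV[R]_n * R)%type.
Local Notation Cn := 'rV[R[i]]_n.
Implicit Types (p u : E) (z : Cn) (b : 'I_n -> E) (V : 'I_n -> E -> E).

Definition points : set E := [set p | dom L p /\ eqn L p = 0].

Definition tangent p u : Prop := 'D_u (eqn L) p = 0.

Definition dpos p u : Cn := vderive (pos L) p u.

Definition immersed : Prop :=
  [/\ open (dom L),
      smooth_on (dom L) (eqn L),
      forall j, csmooth_on (dom L) (fun p => pos L p 0 j),
      forall p, points p -> exists u, 'D_u (eqn L) p != 0
    & forall p u, points p -> tangent p u -> dpos p u = 0 -> u = 0].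

Definition lagrangian : Prop :=
  forall p u v, points p -> tangent p u -> tangent p v ->
    omega (dpos p u) (dpos p v) = 0.

(* The tangent space has dimension n, so n independent vectors form a basis. *)
Definition tangent_basis p b : Prop :=
  (forall i, tangent p (b i)) /\
  (forall a : 'I_n -> R, \sum_i a i *: b i = 0 -> forall i, a i = 0).

(* The fields are defined on the ambient R^n x R but only required to be tangent
   along the level set; only their values there matter. *)
Definition local_frame p V : Prop :=
  (forall i, differentiable (V i) p) /\
  (\forall q \near p, points q -> tangent_basis q (fun i => V i q)).

Definition gram p b : 'M[R]_n :=
  \matrix_(i, j) euclid (dpos p (b i)) (dpos p (b j)).

(* [o p b] says whether the basis [b] of the tangent space at [p] is positive. *)
Definition orientation (o : E -> ('I_n -> E) -> bool) : Prop :=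
  (forall p b (A : 'M[R]_n), points p -> tangent_basis p b -> A \in unitmx ->
     o p (fun i => \sum_j A i j *: b j) = ((0 < \det A) == o p b)) /\
  (forall p V, points p -> local_frame p V ->
     \forall q \near p, points q -> o q (fun i => V i q) = o p (fun i => V i p)).

Definition vol (o : E -> ('I_n -> E) -> bool) p b : R :=
  (if o p b then 1 else -1) * Num.sqrt (\det (gram p b)).

Definition lagrangian_angle {k} (o : E -> ('I_n -> E) -> bool)
    (theta : E -> angle R k) : Prop :=
  forall p b, points p -> tangent_basis p b ->
    dz (fun i => dpos p (b i)) = expi (theta p) * (vol o p b)%:C.

Definition special_lagrangian : Prop :=
  [/\ immersed, lagrangian
    & exists o (t : angle R RealAngle),
        orientation o /\ lagrangian_angle o (fun=> t)].

Definition is_normal_part p z y : Prop :=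
  (forall u, tangent p u -> euclid y (dpos p u) = 0) /\
  (exists u, tangent p u /\ z = y + dpos p u).

Definition normal_part p z : Cn := xget 0 [set y | is_normal_part p z y].

(* II(u, V p) for a tangent vector [u] and a tangent field [V] near [p]. *)
Definition second_form p u (V : E -> E) : Cn :=
  normal_part p (vderive (fun q => dpos q (V q)) p u).

Definition frame_mean_curvature p V : Cn :=
  let G := gram p (fun i => V i p) in
  \sum_i \sum_j (invmx G i j)%:C *: second_form p (V i p) (V j).

(* The trace does not depend on the local frame used to compute it. *)
Definition is_mean_curvature p (H : Cn) : Prop :=
  (exists V, local_frame p V) /\
  (forall V, local_frame p V -> frame_mean_curvature p V = H).

Definition self_similar (c : R) : Prop :=
  forall p, points p -> is_mean_curvature p (c%:C *: normal_part p (pos L p)).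

Definition self_expander : Prop := exists c, 0 < c /\ self_similar c.

Definition self_shrinker : Prop := exists c, c < 0 /\ self_similar c.

End Submanifold.

Definition quadric_family (R : realType) (n : nat) (lambda : 'I_n -> R) (C : R)
    (I : set R) (w : 'I_n -> R -> R[i]) : submanifold R n :=
  {| dom := [set p | I p.2] ;
     eqn := fun p => \sum_j lambda j * p.1 0 j ^+ 2 - C ;
     pos := fun p => \row_j ((p.1 0 j)%:C * w j p.2) |}.

(* Main.v *)
Require Import Defs.
From HB Require Import structures.
From mathcomp Require Import all_boot all_order all_algebra generic_quotient.
From mathcomp Require Import all_classical all_reals all_analysis.
From mathcomp Require Import complex.
From mathcomp Require Import ring lra.

Set Implicit Arguments.
Unset Strict Implicit.
Unset Printing Implicit Defensive.

Import Order.TTheory GRing.Theory Num.Theory.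
Import numFieldNormedType.Exports.

Local Open Scope classical_set_scope.
Local Open Scope ring_scope.
Local Open Scope complex_scope.

(** Why the family is Lagrangian, with angle theta, and self-similar.

    Put Q = e^(i theta) conj(w_1 ... w_n) and r_j = |w_j|^2.  The differential
    equation says that w_j' = lambda_j Q / conj(w_j), so that w_j' conj(w_j) is
    lambda_j Q: all these products point in one direction.  A tangent vector
    u = (u_1, ..., u_n, u_s) of the level set satisfies
    sum_j lambda_j x_j u_j = 0, and the position map sends it to the vector
    with entries u_j w_j + x_j u_s w_j'.  In the Hermitian product of two such
    vectors the mixed terms are multiples of sum_j lambda_j x_j u_j, so the
    product is real ([hdot_dF]) and equal to

      g(u, v) = sum_j r_j u_j v_j + |Q|^2 b u_s v_s,
      where b = sum_j lambda_j^2 x_j^2 / r_j > 0.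

    Its imaginary part being minus the symplectic form, the map is Lagrangian;
    as g is positive definite, it is an immersion.

    Angle.  The complex matrix of a tangent frame is a real matrix times an
    invertible factor of determinant Q w_1 ... w_n = e^(i theta) |w_1 ... w_n|^2
    ([det_dF_mx]); the sign of the real determinant is the orientation.

    Mean curvature.  The second fundamental form of u and v is the normal part
    of the explicit vector [normal_acceleration] u v: the second derivative of
    the position map, corrected by a multiple of the position vector because
    tangent fields have to follow the curved level set ([second_formE]).  The
    normal bundle is i times the tangent bundle, so a normal vector is known
    from the imaginary parts of its Hermitian products with tangent vectors t.
    The metric g is diagonal on R^n x R, so its inverse on the tangent space is
    explicit ([trace_ss], [trace_sx], [trace_xx]), and the trace is theta' t_s
    ([trace_normal_acceleration]): this is the identity H = J grad theta.  For the position vector the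
    same product is - C (Im Q) t_s ([Im_hdot_position]), and
    theta' = - alpha Im Q, whence C H = alpha F^perp
    ([frame_mean_curvatureE]). *)

(** * Complex numbers and the Hermitian product *)

Section ReIm.
Context {R : realType}.
Implicit Types z y : R[i].

Lemma Re_mul z y :
  complex.Re (z * y) = complex.Re z * complex.Re y - complex.Im z * complex.Im y.
Proof. by case: z; case: y. Qed.

Lemma Im_mul z y :
  complex.Im (z * y) = complex.Re z * complex.Im y + complex.Im z * complex.Re y.
Proof. by case: z; case: y. Qed.

Lemma Re_add z y : complex.Re (z + y) = complex.Re z + complex.Re y.
Proof. by case: z; case: y. Qed.

Lemma Im_add z y : complex.Im (z + y) = complex.Im z + complex.Im y.
Proof. by case: z; case: y. Qed.

Lemma Re_conjc z : complex.Re (conjc z) = complex.Re z.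
Proof. by case: z. Qed.

Lemma Im_conjc z : complex.Im (conjc z) = - complex.Im z.
Proof. by case: z. Qed.

Lemma Re_opp z : complex.Re (- z) = - complex.Re z.
Proof. by case: z. Qed.

Lemma Im_opp z : complex.Im (- z) = - complex.Im z.
Proof. by case: z. Qed.

Definition reimE := (Re_mul, Im_mul, Re_add, Im_add,
  Re_conjc, Im_conjc, Re_opp, Im_opp).

Lemma Re_sum (J : Type) (s : seq J) P (f : J -> R[i]) :
  complex.Re (\sum_(j <- s | P j) f j) = \sum_(j <- s | P j) complex.Re (f j).
Proof. by apply: big_morph => // z y; rewrite Re_add. Qed.

Lemma Im_sum (J : Type) (s : seq J) P (f : J -> R[i]) :
  complex.Im (\sum_(j <- s | P j) f j) = \sum_(j <- s | P j) complex.Im (f j).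
Proof. by apply: big_morph => // z y; rewrite Im_add. Qed.

Lemma complex_eq z y :
  complex.Re z = complex.Re y -> complex.Im z = complex.Im y -> z = y.
Proof. by case: z => a b; case: y => c d /= -> ->. Qed.

Definition normsq z : R := complex.Re z ^+ 2 + complex.Im z ^+ 2.

Lemma mul_conj z : z * conjc z = (normsq z)%:C.
Proof. by rewrite /normsq; case: z => a b; apply: complex_eq => /=; ring. Qed.

Lemma normsq_gt0 z : z != 0 -> 0 < normsq z.
Proof.
case: z => a b; rewrite eq_complex /= negb_and /normsq /= => h.
rewrite lt_def addr_ge0 ?sqr_ge0 // andbT paddr_eq0 ?sqr_ge0 // !expf_eq0 /=.
by rewrite negb_and.
Qed.

Lemma normsq0 : normsq 0 = 0.
Proof. by rewrite /normsq /= expr0n addr0. Qed.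

Lemma normsqM z y : normsq (z * y) = normsq z * normsq y.
Proof. by rewrite /normsq !reimE; ring. Qed.

Lemma normsq_real (a : R) : normsq a%:C = a ^+ 2.
Proof. by rewrite /normsq /= expr0n addr0. Qed.

Lemma inv_conj z : z != 0 -> (conjc z)^-1 = ((normsq z)^-1)%:C * z.
Proof.
move=> z0; have cz0 : conjc z != 0 by rewrite conjc_eq0.
have r0 : normsq z != 0 by rewrite gt_eqF // normsq_gt0.
apply: (mulfI cz0); rewrite divff // mulrCA [conjc z * z]mulrC mul_conj.
by rewrite -rmorphM mulVf.
Qed.

End ReIm.

Section Hermitian.
Context {R : realType} {n : nat}.
Implicit Types z y : 'rV[R[i]]_n.

(** The real part is the Euclidean product and the imaginary part is minus the
    symplectic form, so one identity about this product settles both the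
    induced metric and the Lagrangian condition. *)
Definition hdot z y : R[i] := \sum_j z 0 j * conjc (y 0 j).

Lemma Re_hdot z y : complex.Re (hdot z y) = euclid z y.
Proof.
by rewrite Re_sum; apply: eq_bigr => j _; rewrite !reimE; ring.
Qed.

Lemma Im_hdot z y : complex.Im (hdot z y) = - omega z y.
Proof.
by rewrite Im_sum -sumrN; apply: eq_bigr => j _; rewrite !reimE; ring.
Qed.

Lemma hdotDl z z' y : hdot (z + z') y = hdot z y + hdot z' y.
Proof. by rewrite -big_split; apply: eq_bigr => j _; rewrite mxE mulrDl. Qed.

Lemma hdotZl a z y : hdot (a *: z) y = a * hdot z y.
Proof. by rewrite mulr_sumr; apply: eq_bigr => j _; rewrite mxE mulrA. Qed.

Lemma hdotBl z z' y : hdot (z - z') y = hdot z y - hdot z' y.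
Proof. by rewrite -scaleN1r hdotDl hdotZl mulN1r. Qed.

Lemma hdot0l y : hdot 0 y = 0.
Proof. by rewrite -(scale0r 0) hdotZl mul0r. Qed.

Lemma hdot_suml (J : Type) (s : seq J) P (f : J -> 'rV[R[i]]_n) y :
  hdot (\sum_(j <- s | P j) f j) y = \sum_(j <- s | P j) hdot (f j) y.
Proof.
elim/big_rec2: _ => [|j b c _ <-]; first exact: hdot0l.
by rewrite hdotDl.
Qed.

End Hermitian.

(** The matrix determinant lemma, by conjugating with unipotent block matrices. *)
Lemma det_1_add_mul (F : comNzRingType) n (u : 'cV[F]_n) (v : 'rV[F]_n) :
  \det (1%:M + u *m v) = 1 + (v *m u) 0 0.
Proof.
have E : block_mx 1%:M 0 v 1%:M *m block_mx (1%:M + u *m v) u 0 1%:M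
    *m block_mx 1%:M 0 (- v) 1%:M = block_mx 1%:M u 0 (1%:M + v *m u).
  rewrite !mulmx_block !(mul1mx, mulmx1, mul0mx, mulmx0, addr0, add0r).
  rewrite !mulmxN addrK mulmxDr mulmx1 mulmxDl mul1mx mulmxA.
  by rewrite [v *m u *m v + v]addrC subrr [v *m u + _]addrC.
have := congr1 determinant E.
rewrite !det_mulmx !det_lblock !det_ublock !det1 !mul1r !mulr1 => ->.
by rewrite det_mx11 !mxE.
Qed.

Section MTrace.
Context {R : realType} {n : nat}.
Implicit Types (A : 'M[R]_n) (f g : 'I_n -> 'I_n -> R).

(** For A the inverse of the Gram matrix of a basis, this is the metric trace of
    the bilinear form with values f i j on that basis. *)
Definition mtrace A f : R := \sum_i \sum_j A i j * f i j.

Lemma mtraceD A f g : mtrace A (fun i j => f i j + g i j) = mtrace A f + mtrace A g.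
Proof.
rewrite /mtrace -big_split; apply: eq_bigr => i _; rewrite -big_split.
by apply: eq_bigr => j _; rewrite mulrDr.
Qed.

Lemma mtraceZ A c f : mtrace A (fun i j => c * f i j) = c * mtrace A f.
Proof.
rewrite /mtrace mulr_sumr; apply: eq_bigr => i _; rewrite mulr_sumr.
by apply: eq_bigr => j _; rewrite mulrCA.
Qed.

Lemma mtrace_sum A (J : Type) (s : seq J) (f : J -> 'I_n -> 'I_n -> R) :
  mtrace A (fun i j => \sum_(k <- s) f k i j) = \sum_(k <- s) mtrace A (f k).
Proof.
rewrite /mtrace [RHS]exchange_big; apply: eq_bigr => i _; rewrite exchange_big.
by apply: eq_bigr => j _; rewrite mulr_sumr.
Qed.

Lemma eq_mtrace A f g : (forall i j, f i j = g i j) -> mtrace A f = mtrace A g.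
Proof. by move=> fg; apply: eq_bigr => i _; apply: eq_bigr => j _; rewrite fg. Qed.

End MTrace.


(** * Linear algebra at one point of the level set *)

Section Fibre.
Context {R : realType} {n : nat}.
Variables (lambda x : 'I_n -> R) (w : 'I_n -> R[i]) (Q : R[i]).
Hypothesis w_neq0 : forall j, w j != 0.
Local Notation E := ('rV[R]_n * R)%type.
Implicit Types u v t : E.

(** The right-hand side of the differential equation at a fixed time, with
    Q = e^(i theta) conj(w_1 ... w_n): dividing by conj(w_j) omits the j-th
    factor of the product. *)
Definition velocity j : R[i] := (lambda j)%:C * Q / conjc (w j).

Definition dF u : 'rV[R[i]]_n :=
  \row_j ((u.1 0 j)%:C * w j + (x j * u.2)%:C * velocity j).

(** Half the differential of the level function: tangent vectors are its kernel. *)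
Definition conormal u : R := \sum_j lambda j * x j * u.1 0 j.

(** The squared length of [conormal] for the metric with weights |w_j|^2. *)
Definition conormal_sq : R := \sum_j (lambda j * x j) ^+ 2 / normsq (w j).

Definition metric u v : R :=
  \sum_j normsq (w j) * (u.1 0 j * v.1 0 j) + normsq Q * conormal_sq * (u.2 * v.2).

Lemma normsq_w_neq0 j : normsq (w j) != 0.
Proof. by rewrite gt_eqF // normsq_gt0. Qed.

Lemma velocityE j : velocity j = (lambda j / normsq (w j))%:C * Q * w j.
Proof. by rewrite /velocity inv_conj // rmorphM /=; ring. Qed.

Lemma dFD u v : dF (u + v) = dF u + dF v.
Proof. by apply/rowP => j; rewrite !mxE /= mulrDr !rmorphD /=; ring. Qed.

Lemma dFZ a u : dF (a *: u) = a%:C *: dF u.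
Proof.
by apply/rowP => j; rewrite !mxE /= [x j * _]mulrCA !rmorphM /=; ring.
Qed.

Lemma dFB u v : dF (u - v) = dF u - dF v.
Proof. by rewrite -scaleN1r dFD dFZ rmorphN1 scaleN1r. Qed.

Lemma dF0 : dF 0 = 0.
Proof. by rewrite -(scale0r (0 : E)) dFZ scale0r. Qed.

Lemma dF_sum (J : Type) (s : seq J) P (f : J -> E) :
  dF (\sum_(j <- s | P j) f j) = \sum_(j <- s | P j) dF (f j).
Proof. by apply: big_morph => [u v|]; [exact: dFD|exact: dF0]. Qed.

Lemma conormalD u v : conormal (u + v) = conormal u + conormal v.
Proof. by rewrite -big_split; apply: eq_bigr => j _ /=; rewrite mxE mulrDr. Qed.

Lemma conormalZ a u : conormal (a *: u) = a * conormal u.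
Proof. by rewrite mulr_sumr; apply: eq_bigr => j _ /=; rewrite mxE mulrCA. Qed.

Lemma conormalB u v : conormal (u - v) = conormal u - conormal v.
Proof. by rewrite -scaleN1r conormalD conormalZ mulN1r. Qed.

Lemma conormal_sum (J : Type) (s : seq J) P (f : J -> E) :
  conormal (\sum_(j <- s | P j) f j) = \sum_(j <- s | P j) conormal (f j).
Proof.
apply: big_morph => [u v|]; first exact: conormalD.
by rewrite -(scale0r (0 : E)) conormalZ mul0r.
Qed.

(** The mixed terms are [conormal] u conj(Q) v_s and [conormal] v Q u_s because
    w_j' conj(w_j) = lambda_j Q with the same Q for all j. *)
Lemma hdot_dF u v : conormal u = 0 -> conormal v = 0 ->
  hdot (dF u) (dF v) = (metric u v)%:C.
Proof.
move=> u0 v0.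
have -> : hdot (dF u) (dF v) = (metric u v)%:C
    + (conormal u * v.2)%:C * conjc Q + (conormal v * u.2)%:C * Q.
  rewrite /metric /conormal /conormal_sq !mulr_sumr !mulr_suml -big_split /=.
  rewrite !rmorph_sum /= !mulr_suml -!big_split /=; apply: eq_bigr => j _.
  rewrite !mxE velocityE; have := normsq_w_neq0 j; rewrite /normsq.
  case: (w j) => p q; case: Q => a b /= rj.
  by apply: complex_eq; rewrite !reimE /= ?reimE /=; field.
by rewrite u0 v0 !mul0r !addr0.
Qed.

Lemma metricC u v : metric u v = metric v u.
Proof.
rewrite /metric [u.2 * _]mulrC; congr (_ + _).
by apply: eq_bigr => j _; rewrite [u.1 0 j * _]mulrC.
Qed.

Lemma metricDl u u' v : metric (u + u') v = metric u v + metric u' v.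
Proof.
rewrite /metric /= [(u.2 + u'.2) * _]mulrDl mulrDr addrACA -big_split; congr (_ + _).
by apply: eq_bigr => j _; rewrite /= mxE; ring.
Qed.

Lemma metricZl a u v : metric (a *: u) v = a * metric u v.
Proof.
rewrite /metric mulrDr; congr (_ + _); last by rewrite /= /GRing.scale /=; ring.
by rewrite mulr_sumr; apply: eq_bigr => j _; rewrite /= mxE; ring.
Qed.

Lemma metric_suml (J : Type) (s : seq J) P (f : J -> E) v :
  metric (\sum_(j <- s | P j) f j) v = \sum_(j <- s | P j) metric (f j) v.
Proof.
apply: (big_morph (metric^~ v)) => [u u'|]; first exact: metricDl.
by rewrite -(scale0r (0 : E)) metricZl mul0r.
Qed.

Variable C : R.
Hypotheses (C_neq0 : C != 0) (lambda_neq0 : forall j, lambda j != 0).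
Hypotheses (Q_neq0 : Q != 0) (xC : \sum_j lambda j * x j ^+ 2 = C).

Lemma conormal_sq_gt0 : 0 < conormal_sq.
Proof.
have nn j : 0 <= (lambda j * x j) ^+ 2 / normsq (w j).
  by rewrite divr_ge0 ?sqr_ge0 // ltW // normsq_gt0.
rewrite lt_def sumr_ge0 ?andbT //; apply: contra C_neq0 => /eqP h.
rewrite -xC big1 // => j _.
have /eqP := h; rewrite psumr_eq0 // => /allP /(_ j); rewrite mem_index_enum => /(_ isT).
rewrite mulf_eq0 invr_eq0 (negPf (normsq_w_neq0 _)) orbF sqrf_eq0 mulf_eq0.
by rewrite (negPf (lambda_neq0 _)) /= => /eqP ->; rewrite expr0n mulr0.
Qed.

Lemma time_coef_gt0 : 0 < normsq Q * conormal_sq.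
Proof. by rewrite mulr_gt0 ?conormal_sq_gt0 // normsq_gt0. Qed.

Lemma metric_eq0 u : metric u u = 0 -> u = 0.
Proof.
move=> /eqP; rewrite paddr_eq0.
- case/andP; rewrite psumr_eq0.
  + move=> /allP h1; rewrite mulf_eq0 (gt_eqF time_coef_gt0) /= mulf_eq0 orbb => /eqP h2.
    case: u h1 h2 => u1 u2 /= h1 ->; congr (_, _); apply/rowP => j; rewrite mxE.
    have := h1 j; rewrite mem_index_enum => /(_ isT).
    by rewrite mulf_eq0 (negPf (normsq_w_neq0 _)) /= mulf_eq0 orbb => /eqP.
  + by move=> j _; apply: mulr_ge0; rewrite -?expr2 ?sqr_ge0 // ltW ?normsq_gt0.
- by apply: sumr_ge0 => j _; apply: mulr_ge0; rewrite -?expr2 ?sqr_ge0 // ltW ?normsq_gt0.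
- by apply: mulr_ge0; rewrite -?expr2 ?sqr_ge0 // ltW ?time_coef_gt0.
Qed.

Lemma dF_inj u : conormal u = 0 -> dF u = 0 -> u = 0.
Proof.
move=> u0 du0; apply: metric_eq0; have := hdot_dF u0 u0.
by rewrite du0 hdot0l => /complexI.
Qed.

(** The tangential component of z.  The metric being diagonal, it can be solved
    for coordinatewise; the multiplier k takes away the part that leaves the
    kernel of [conormal]. *)
Lemma tangential_part (z : 'rV[R[i]]_n) :
  exists2 t, conormal t = 0 &
    forall v, conormal v = 0 -> complex.Re (hdot z (dF v)) = metric t v.
Proof.
pose A j := complex.Re (z 0 j * conjc (w j)).
pose B := \sum_j x j * complex.Re (z 0 j * conjc (velocity j)).
pose k := (\sum_j lambda j * x j * A j / normsq (w j)) / conormal_sq.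
have b0 := lt0r_neq0 conormal_sq_gt0; have q0 := lt0r_neq0 (normsq_gt0 Q_neq0).
exists (\row_j ((A j - k * (lambda j * x j)) / normsq (w j)),
        B / (normsq Q * conormal_sq)).
  rewrite /conormal /=.
  transitivity (\sum_j lambda j * x j * A j / normsq (w j) - k * conormal_sq).
    2: by rewrite /k divfK // subrr.
  rewrite mulr_sumr -sumrB; apply: eq_bigr => j _; rewrite mxE.
  by have := normsq_w_neq0 j => ?; field.
move=> v v0; rewrite /metric /=.
have -> : normsq Q * conormal_sq * (B / (normsq Q * conormal_sq) * v.2) = v.2 * B.
  by field; rewrite b0 q0.
have -> : \sum_j normsq (w j) * ((\row_j0 ((A j0 - k * (lambda j0 * x j0))
     / normsq (w j0))) 0 j * v.1 0 j) = \sum_j A j * v.1 0 j - k * conormal v.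
  rewrite mulr_sumr -sumrB; apply: eq_bigr => j _; rewrite mxE.
  by have := normsq_w_neq0 j => ?; field.
rewrite v0 mulr0 subr0 /B mulr_sumr -big_split Re_sum; apply: eq_bigr => j _.
by rewrite /A !mxE !reimE /=; ring.
Qed.

Variable d : R.

Definition log_rate : R := \sum_j lambda j / normsq (w j).

(** The derivative of [velocity] when theta' = d.  Its logarithmic derivative is
    i d plus the sum over l <> j of conj(w_l' / w_l), and
    conj(w_l' / w_l) = lambda_l conj(Q) / |w_l|^2. *)
Definition acceleration j : R[i] :=
  velocity j * ('i * d%:C
    + conjc Q * (log_rate - lambda j / normsq (w j))%:C).

(** The second derivative of the position map (x, s) |-> (x_j w_j(s))_j. *)
Definition hessian u v : 'rV[R[i]]_n :=
  \row_j ((u.1 0 j * v.2 + u.2 * v.1 0 j)%:C * velocity j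
    + (x j * (u.2 * v.2))%:C * acceleration j).

Definition qform u v : R := \sum_j lambda j * u.1 0 j * v.1 0 j.

Definition position : 'rV[R[i]]_n := \row_j ((x j)%:C * w j).

Lemma Im_hdot_position t :
  complex.Im (hdot position (dF t)) = - (complex.Im Q * C * t.2).
Proof.
rewrite Im_sum -xC mulr_sumr mulr_suml -sumrN; apply: eq_bigr => j _.
rewrite !mxE velocityE //; have := normsq_w_neq0 j; rewrite /normsq.
by case: (w j) => p q; case: Q => a b rj; rewrite !reimE /= ?reimE /=; field.
Qed.

(** The coefficient of u_s v_s t_s in the cubic form
    Im <hessian u v, dF t>. *)
Definition cubic_time : R := normsq Q * (conormal_sq * (d - complex.Im Q * log_rate)
  + complex.Im Q * \sum_j lambda j * (lambda j * x j / normsq (w j)) ^+ 2).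

(** The imaginary part of w_j'' conj(w_j) is lambda_j d (Re Q), so the terms
    x_j t_j w_j'' conj(w_j) add up to a multiple of [conormal] t. *)
Lemma Im_hdot_hessian u v t : conormal t = 0 ->
  complex.Im (hdot (hessian u v) (dF t)) =
  complex.Im Q * (v.2 * qform u t + u.2 * qform v t) + u.2 * v.2 * t.2 * cubic_time.
Proof.
move=> t0; rewrite /hessian /cubic_time /acceleration; move: log_rate => s.
transitivity (complex.Im Q * (v.2 * qform u t + u.2 * qform v t)
    + u.2 * v.2 * t.2 * (normsq Q * (conormal_sq * (d - complex.Im Q * s)
      + complex.Im Q * \sum_j lambda j * (lambda j * x j / normsq (w j)) ^+ 2))
    + complex.Re Q * d * (u.2 * v.2) * conormal t).
  2: by rewrite t0 mulr0 addr0.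
rewrite Im_sum /qform /conormal_sq /conormal.
rewrite 4!mulr_sumr -big_split /= mulr_sumr mulr_suml -big_split /=.
rewrite !mulr_sumr -!big_split /=; apply: eq_bigr => j _.
rewrite !mxE velocityE //.
have := normsq_w_neq0 j; rewrite /normsq.
case: (w j) => p q; case: Q => a b rj.
by rewrite !reimE /= ?reimE /=; field.
Qed.

(** A tangent field extending v has a derivative along u with [conormal] equal
    to - [qform] u v.  Modulo tangent vectors this derivative is therefore
    - [qform] u v / C times (x, 0), which dF sends to the position vector. *)
Definition normal_acceleration u v : 'rV[R[i]]_n :=
  hessian u v - (qform u v / C)%:C *: position.

Section Frame.
Variable e : 'I_n -> E.
Hypothesis e_tangent : forall i, conormal (e i) = 0.

Definition metric_mx : 'M[R]_n := \matrix_(i, j) metric (e i) (e j).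
Definition dF_mx : 'M[R[i]]_n := \matrix_(i, j) dF (e i) 0 j.
(** What [dF_mx] becomes for Q = 1 after division of column j by w_j. *)
Definition frame_mx : 'M[R]_n :=
  \matrix_(i, j) ((e i).1 0 j + (e i).2 * (lambda j * x j / normsq (w j))).

Lemma dF_mx_conj :
  dF_mx *m (map_mx conjc dF_mx)^T = map_mx (real_complex R) metric_mx.
Proof.
apply/matrixP => i j; rewrite !mxE -hdot_dF //.
by apply: eq_bigr => k _; rewrite !mxE.
Qed.

Lemma normsq_det_dF_mx : normsq (\det dF_mx) = \det metric_mx.
Proof.
have := congr1 determinant dF_mx_conj.
by rewrite det_mulmx det_tr !det_map_mx mul_conj => /complexI.
Qed.

(** Let X be the column of the lambda_j x_j and N the row of the
    lambda_j x_j / |w_j|^2.  Tangency of the frame says that [frame_mx] maps X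
    to [conormal_sq] times the column of the s-components, so passing from 1 to
    Q is right multiplication by 1 + (Q - 1) / [conormal_sq] X N, a matrix of
    determinant Q as N X = [conormal_sq]. *)
Lemma det_dF_mx : \det dF_mx = (\det frame_mx)%:C * (Q * \prod_j w j).
Proof.
pose N : 'rV[R[i]]_n := \row_j (lambda j * x j / normsq (w j))%:C.
pose X : 'cV[R[i]]_n := \col_j (lambda j * x j)%:C.
have b0 := lt0r_neq0 conormal_sq_gt0.
have NX : (N *m X) 0 0 = conormal_sq%:C.
  rewrite mxE rmorph_sum; apply: eq_bigr => j _; rewrite !mxE -rmorphM.
  by congr (_ %:C); rewrite mulrAC expr2.
have UX : map_mx (real_complex R) frame_mx *m X = \col_i (conormal_sq * (e i).2)%:C.
  apply/matrixP => i j; rewrite !mxE mulr_suml rmorph_sum /=.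
  transitivity (\sum_k ((lambda k * x k * (e i).1 0 k)
      + (lambda k * x k) ^+ 2 / normsq (w k) * (e i).2)%:C : R[i]).
    by apply: eq_bigr => k _; rewrite !mxE -rmorphM; congr (_ %:C); ring.
  rewrite -!rmorph_sum big_split /=; congr (_ %:C).
  by rewrite [X in X + _](e_tangent i) add0r.
have -> : dF_mx = map_mx (real_complex R) frame_mx
    *m (1%:M + X *m (((Q - 1) / conormal_sq%:C) *: N)) *m diag_mx (\row_j w j).
  rewrite mulmxDr mulmx1 mulmxA UX; apply/matrixP => i j.
  rewrite mul_mx_diag !mxE big_ord1 !mxE velocityE //.
  rewrite !rmorphM !rmorphD !rmorphM /=.
  have : conormal_sq%:C != 0 by rewrite fmorph_eq0.
  move: (conormal_sq%:C) ((normsq (w j))^-1)%:C => c z c0.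
  by field.
rewrite !det_mulmx det_1_add_mul -scalemxAl mxE NX det_map_mx det_diag.
under eq_bigr do rewrite mxE.
rewrite divfK ?fmorph_eq0 //; ring.
Qed.

Hypothesis e_free : forall a : 'I_n -> R, \sum_i a i *: e i = 0 -> forall i, a i = 0.

Lemma metric_mx_unit : metric_mx \in unitmx.
Proof.
rewrite unitmxE unitfE; apply/det0P => -[a a0 aG]; case/eqP: a0.
apply/rowP => i; rewrite mxE; apply: (e_free (a := fun i => a 0 i)) => {i}.
apply: metric_eq0.
rewrite metric_suml big1 // => j _; rewrite metricZl.
suff -> : metric (e j) (\sum_i a 0 i *: e i) = (a *m metric_mx) 0 j.
  by rewrite aG mxE mulr0.
rewrite metricC metric_suml mxE; apply: eq_bigr => i _.
by rewrite metricZl mxE.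
Qed.

Lemma frame_mx_det_neq0 : \det frame_mx != 0.
Proof.
have := metric_mx_unit; rewrite unitmxE unitfE -normsq_det_dF_mx det_dF_mx.
by apply: contra => /eqP ->; rewrite rmorph0 mul0r normsq0.
Qed.

Local Notation Ginv := (invmx metric_mx).
Local Notation tr := (mtrace Ginv).

(** If M is the frame matrix, M M^* = G gives M^* G^-1 M = 1, so every vector of
    C^n is recovered from its Hermitian products with the frame.  For dF v those
    products are real, and injectivity of dF brings the expansion back to v.
    This replaces a dimension count for the tangent space. *)
Lemma metric_mx_expand v : conormal v = 0 ->
  \sum_i \sum_j (Ginv i j * metric v (e i)) *: e j = v.
Proof.
move=> v0; apply/eqP; rewrite -subr_eq0 -scaleN1r; apply/eqP.
apply: dF_inj.
  rewrite conormalD conormalZ v0 mulr0 addr0 conormal_sum big1 // => i _.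
  by rewrite conormal_sum big1 // => j _; rewrite conormalZ e_tangent mulr0.
pose Gc := map_mx (real_complex R) Ginv.
have MGM : ((map_mx conjc dF_mx)^T *m Gc) *m dF_mx = 1%:M.
  apply: mulmx1C; rewrite mulmxA dF_mx_conj -map_mxM mulmxV ?metric_mx_unit //.
  by rewrite map_mx1.
have E : dF (\sum_i \sum_j (Ginv i j * metric v (e i)) *: e j)
    = dF v *m (((map_mx conjc dF_mx)^T *m Gc) *m dF_mx).
  rewrite mulmxA mulmxA; apply/rowP => k.
  rewrite exchange_big dF_sum summxE mxE; apply: eq_bigr => j _.
  rewrite dF_sum summxE mxE mulr_suml; apply: eq_bigr => i _.
  rewrite dFZ [in RHS]mxE !mxE rmorphM /= -hdot_dF //.
  rewrite /hdot; under [in RHS]eq_bigr do rewrite !mxE.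
  under [in LHS]eq_bigr do rewrite !mxE.
  ring.
by rewrite dFD dFZ E MGM mulmx1 rmorphN1 scaleN1r subrr.
Qed.

Lemma expand_snd v : conormal v = 0 ->
  \sum_i \sum_j Ginv i j * metric v (e i) * (e j).2 = v.2.
Proof.
move=> v0; rewrite -[in RHS](metric_mx_expand v0).
rewrite (big_morph snd (id1 := 0) (op1 := +%R)) //; apply: eq_bigr => i _.
by rewrite (big_morph snd (id1 := 0) (op1 := +%R)).
Qed.

Lemma expand_fst v k : conormal v = 0 ->
  \sum_i \sum_j Ginv i j * metric v (e i) * (e j).1 0 k = v.1 0 k.
Proof.
move=> v0; rewrite -[in RHS](metric_mx_expand v0).
have fD : {morph (fun u : E => u.1 0 k) : u v / u + v} by move=> u u'; rewrite mxE.
have f0 : (0 : E).1 0 k = 0 by rewrite mxE.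
rewrite (big_morph _ fD f0); apply: eq_bigr => i _.
by rewrite (big_morph _ fD f0); apply: eq_bigr => j _; rewrite mxE.
Qed.

Local Notation c := (normsq Q * conormal_sq).
Local Notation N k := (lambda k * x k / normsq (w k)).

Let c_neq0 : c != 0.
Proof. exact: lt0r_neq0 time_coef_gt0. Qed.

(* The metric gradient of the coordinate s. *)
Let ds : E := (0, c^-1).
Let conormal_ds : conormal ds = 0.
Proof. by apply: big1 => j _; rewrite mxE mulr0. Qed.
Let metric_ds i : metric ds (e i) = (e i).2.
Proof.
rewrite /metric big1 => [|k _]; last by rewrite mxE mul0r mulr0.
by rewrite add0r mulrA divff // mul1r.
Qed.

Lemma trace_ss : tr (fun i j => (e i).2 * (e j).2) = c^-1.
Proof.
rewrite -[RHS](expand_snd conormal_ds); apply: eq_bigr => i _.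
by apply: eq_bigr => j _; rewrite metric_ds mulrA.
Qed.

Lemma trace_sx k : tr (fun i j => (e i).2 * (e j).1 0 k) = 0.
Proof.
transitivity (ds.1 0 k); last by rewrite mxE.
rewrite -(expand_fst _ conormal_ds); apply: eq_bigr => i _.
by apply: eq_bigr => j _; rewrite metric_ds mulrA.
Qed.

Lemma trace_xs k : tr (fun i j => (e i).1 0 k * (e j).2) = 0.
Proof.
rewrite -[RHS](trace_sx k) /mtrace exchange_big; apply: eq_bigr => i _.
apply: eq_bigr => j _; rewrite [_ * (e i).2]mulrC; congr (_ * _).
have GT : Ginv = Ginv^T.
  rewrite trmx_inv; congr invmx; apply/matrixP => a b; rewrite !mxE.
  exact: metricC.
by rewrite [in LHS]GT mxE.
Qed.

Lemma trace_xx k : tr (fun i j => (e i).1 0 k * (e j).1 0 k)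
  = (normsq (w k))^-1 - N k ^+ 2 / conormal_sq.
Proof.
have b0 := lt0r_neq0 conormal_sq_gt0.
(* The metric gradient of the coordinate x_k on the tangent space. *)
pose v : E := (\row_l ((k == l)%:R / normsq (w l) - N k / conormal_sq * N l), 0).
have v0 : conormal v = 0.
  have -> : conormal v = \sum_l lambda l * x l * (k == l)%:R / normsq (w l)
      - N k / conormal_sq * conormal_sq.
    rewrite /conormal_sq mulr_sumr -sumrB; apply: eq_bigr => l _.
    by rewrite mxE; have := normsq_w_neq0 l => ?; ring.
  rewrite (bigD1 k) //= big1 ?eqxx => [|l lk]; last first.
    by rewrite eq_sym (negPf lk) mulr0 mul0r.
  by rewrite mulr1 addr0 divfK // subrr.
have me i : metric v (e i) = (e i).1 0 k.
  rewrite /metric mul0r mulr0 addr0.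
  transitivity (\sum_l (k == l)%:R * (e i).1 0 l - N k / conormal_sq * conormal (e i)).
    rewrite mulr_sumr -sumrB; apply: eq_bigr => l _; rewrite mxE.
    move: (_%:R) (N k / _) (normsq_w_neq0 l) => a b r0.
    by field.
  rewrite e_tangent mulr0 subr0 (bigD1 k) //= big1 ?eqxx ?mul1r ?addr0 // => l lk.
  by rewrite eq_sym (negPf lk) mul0r.
transitivity (v.1 0 k).
  rewrite -(expand_fst _ v0); apply: eq_bigr => i _.
  by apply: eq_bigr => j _; rewrite me mulrA.
by rewrite mxE eqxx mul1r expr2; ring.
Qed.

(** The mixed traces vanish, and the contributions of [log_rate] and of
    sum_k lambda_k (lambda_k x_k / |w_k|^2)^2 cancel between [cubic_time] and
    the trace of [qform].  What is left is the differential of theta. *)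
Lemma trace_normal_acceleration t : conormal t = 0 ->
  tr (fun i j => complex.Im (hdot (normal_acceleration (e i) (e j)) (dF t))) = d * t.2.
Proof.
move=> t0.
have b0 := lt0r_neq0 conormal_sq_gt0.
have q0 := lt0r_neq0 (normsq_gt0 Q_neq0).
rewrite (@eq_mtrace _ _ _ _ (fun i j => complex.Im Q *
    (\sum_k lambda k * t.1 0 k * ((e i).1 0 k * (e j).2) +
     \sum_k lambda k * t.1 0 k * ((e i).2 * (e j).1 0 k)) +
    (t.2 * cubic_time * ((e i).2 * (e j).2) +
     complex.Im Q * t.2 * \sum_k lambda k * ((e i).1 0 k * (e j).1 0 k)))); last first.
  move=> i j; rewrite hdotBl hdotZl !reimE Im_hdot_hessian // Im_hdot_position.
  have -> : \sum_k lambda k * t.1 0 k * ((e i).1 0 k * (e j).2)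
      = (e j).2 * qform (e i) t.
    by rewrite mulr_sumr; apply: eq_bigr => k _; ring.
  have -> : \sum_k lambda k * t.1 0 k * ((e i).2 * (e j).1 0 k)
      = (e i).2 * qform (e j) t.
    by rewrite mulr_sumr; apply: eq_bigr => k _; ring.
  have -> : \sum_k lambda k * ((e i).1 0 k * (e j).1 0 k) = qform (e i) (e j).
    by apply: eq_bigr => k _; ring.
  move: (qform _ _) (qform _ _) (qform _ _) cubic_time => /= A B K c.
  by field.
rewrite !(mtraceD, mtraceZ) !mtrace_sum.
rewrite big1 => [|k _]; last by rewrite mtraceZ trace_xs mulr0.
rewrite big1 => [|k _]; last by rewrite mtraceZ trace_sx mulr0.
rewrite addr0 mulr0 add0r trace_ss.
rewrite (eq_bigr (fun k => lambda k / normsq (w k) - conormal_sq^-1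
    * (lambda k * (lambda k * x k / normsq (w k)) ^+ 2))) => [|k _]; last first.
  by rewrite mtraceZ trace_xx; ring.
rewrite sumrB -mulr_sumr /cubic_time -/log_rate.
move: log_rate (\sum_(k < n) _) => s g.
by field; rewrite b0 q0.
Qed.

(** A basis of the tangent space is a complex basis of C^n, because the frame
    matrix is invertible; this is the Lagrangian splitting C^n = T + iT. *)
Lemma hdot_dF_eq0 y : (forall i, hdot y (dF (e i)) = 0) -> y = 0.
Proof.
move=> ye; have := metric_mx_unit.
rewrite unitmxE unitfE -normsq_det_dF_mx // => D0.
have Mu : dF_mx \in unitmx.
  by rewrite unitmxE unitfE; apply: contra D0 => /eqP ->; rewrite normsq0.
have : dF_mx *m (map_mx conjc y)^T = 0.
  apply/colP => i; rewrite [RHS]mxE.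
  transitivity (conjc (hdot y (dF (e i)))); last by rewrite ye conjc0.
  rewrite mxE rmorph_sum; apply: eq_bigr => j _.
  by rewrite [in RHS]rmorphM /= conjcK mulrC /dF_mx 3!mxE.
move=> /(congr1 (mulmx (invmx dF_mx))).
rewrite mulKmx // mulmx0 => /(congr1 trmx); rewrite trmxK trmx0 => y0.
apply/rowP => j; have := congr1 (fun M : 'rV_n => M 0 j) y0.
by rewrite !mxE => /eqP; rewrite conjc_eq0 => /eqP.
Qed.

End Frame.
End Fibre.

(** * Derivatives of complex-valued maps *)

Section ComplexDerivative.
Context {R : realType} {V : normedModType R}.
Implicit Types (f g : V -> R[i]) (p v : V) (d e : R[i]).

Definition is_cderive p v f d : Prop :=
  is_derive p v (fun q => complex.Re (f q)) (complex.Re d) /\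
  is_derive p v (fun q => complex.Im (f q)) (complex.Im d).

Lemma is_cderive_val p v f d : is_cderive p v f d -> cderive f p v = d.
Proof.
by move=> [[_ dr] [_ di]]; apply: complex_eq; rewrite /= ?dr ?di.
Qed.

Lemma near_eq_is_cderive p v f g d :
  (\forall q \near p, f q = g q) -> is_cderive p v f d -> is_cderive p v g d.
Proof.
by move=> fg [dr di]; split; [apply: near_eq_is_derive dr|apply: near_eq_is_derive di];
  apply: filterS fg => q ->.
Qed.

Lemma is_cderive_eq p v f d e : is_cderive p v f d -> d = e -> is_cderive p v f e.
Proof. by move=> ? <-. Qed.

Lemma is_cderive_cst p v d : is_cderive p v (fun=> d) 0.
Proof. by split; exact: is_derive_cst. Qed.

Lemma is_cderive_real p v (f : V -> R) (d : R) :
  is_derive p v f d -> is_cderive p v (fun q => (f q)%:C) d%:C.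
Proof. by split=> //=; exact: is_derive_cst. Qed.

Lemma is_cderiveD p v f g d e : is_cderive p v f d -> is_cderive p v g e ->
  is_cderive p v (fun q => f q + g q) (d + e).
Proof.
move=> [fr fi] [gr gi]; split; rewrite !reimE.
- under [X in is_derive _ _ X]funext do rewrite !reimE.
  exact: is_deriveD.
- under [X in is_derive _ _ X]funext do rewrite !reimE.
  exact: is_deriveD.
Qed.

Lemma is_cderiveM p v f g d e : is_cderive p v f d -> is_cderive p v g e ->
  is_cderive p v (fun q => f q * g q) (d * g p + f p * e).
Proof.
move=> [fr fi] [gr gi]; split; rewrite !reimE.
- under [X in is_derive _ _ X]funext do rewrite !reimE.
  by apply: is_derive_eq; rewrite /GRing.scale /=; ring.
- under [X in is_derive _ _ X]funext do rewrite !reimE.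
  by apply: is_derive_eq; rewrite /GRing.scale /=; ring.
Qed.

Lemma is_cderive_conj p v f d :
  is_cderive p v f d -> is_cderive p v (fun q => conjc (f q)) (conjc d).
Proof.
move=> [fr fi]; split; rewrite !reimE.
- by under [X in is_derive _ _ X]funext do rewrite !reimE.
- under [X in is_derive _ _ X]funext do rewrite !reimE.
  exact: is_deriveN.
Qed.

(** Leibniz' rule in logarithmic form. *)
Lemma is_cderive_prod (J : Type) (s : seq J) (P : pred J) p v
    (f : J -> V -> R[i]) (d : J -> R[i]) :
  (forall j, f j p != 0) -> (forall j, is_cderive p v (f j) (d j)) ->
  is_cderive p v (fun q => \prod_(j <- s | P j) f j q)
    ((\prod_(j <- s | P j) f j p) * \sum_(j <- s | P j) d j / f j p).
Proof.
move=> f0 df; elim: s => [|a s IH].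
  apply: is_cderive_eq (_ : 0 = _); last by rewrite !big_nil mulr0.
  under [X in is_cderive _ _ X]funext do rewrite big_nil.
  exact: is_cderive_cst.
under [X in is_cderive _ _ X]funext do rewrite big_cons.
rewrite !big_cons; case: ifP => // _.
apply: is_cderive_eq (is_cderiveM (df a) IH) _.
by rewrite mulrDr mulrACA; have := f0 a => fa; field.
Qed.

End ComplexDerivative.

Section Lines.
Context {R : realType} {V : normedModType R}.

Lemma is_derive_line (p v : V) (f : V -> R) (d : R) :
  is_derive (0 : R) 1 (fun h : R => f (h *: v + p)) d -> is_derive p v f d.
Proof.
move=> [df fd]; split; first exact: (proj2 (derivable1P f p v) df).
rewrite -fd /derive; congr (lim _); apply: (congr1 (fun g => g @ 0^')); apply/funext => h /=.
by rewrite addr0 scale0r add0r [_%:A]mulr1.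
Qed.

(** The chain rule along a curve; it computes a directional derivative of phi
    from the values of phi on a curve with the right velocity. *)
Lemma derive_curve (phi : V -> R) (c : R -> V) (p u : V) :
  c 0 = p -> differentiable c 0 -> 'd c 0 1 = u -> differentiable phi p ->
  'D_1 (phi \o c) 0 = 'D_u phi p.
Proof.
move=> c0 dc cu dphi; have dphi' : differentiable phi (c 0) by rewrite c0.
rewrite (deriveE _ (differentiable_comp dc dphi')) (deriveE _ dphi).
by rewrite (diff_comp dc dphi') /= cu c0.
Qed.

Lemma is_derive_scale (a : R -> R) (v : V) (s da : R) :
  is_derive s 1 a da -> is_derive s 1 (fun h => a h *: v) (da *: v).
Proof.
move=> [/derivable1_diffP dfa <-].
apply: DeriveDef; first exact/diff_derivable/differentiableZl.
by rewrite (deriveE _ (differentiableZl v dfa)) diffZl // -deriveE.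
Qed.

End Lines.

Section ProductSpace.
Context {R : realType} {n : nat}.
Local Notation E := ('rV[R]_n * R)%type.
Implicit Types p v : E.

Lemma is_derive_coord p v j : is_derive p v (fun q : E => q.1 0 j) (v.1 0 j).
Proof.
apply: is_derive_line.
rewrite (_ : (fun _ => _) = (fun h : R => h * v.1 0 j + p.1 0 j)); last first.
  by apply/funext => h; rewrite !mxE.
by apply: is_derive_eq; rewrite /GRing.scale /=; ring.
Qed.

Lemma is_derive_snd p v (f : R -> R) d :
  is_derive p.2 1 f d -> is_derive p v (fun q : E => f q.2) (v.2 * d).
Proof.
move=> fd; apply: is_derive_line.
have gd : is_derive (0 : R) 1 (fun h : R => h * v.2 + p.2) v.2.
  by apply: is_derive_eq; rewrite /GRing.scale /=; ring.
rewrite (_ : (fun _ => _) = f \o (fun h : R => h * v.2 + p.2)) //.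
rewrite mulrC; apply: (@is_derive1_comp _ f _ 0 d v.2).
by rewrite mul0r add0r.
Qed.

Lemma is_cderive_snd p v (f : R -> R[i]) d :
  is_cderive p.2 1 f d -> is_cderive p v (fun q : E => f q.2) ((v.2)%:C * d).
Proof.
move=> [fr fi]; split; rewrite !reimE /= mul0r ?subr0 ?addr0.
  exact: (@is_derive_snd p v (fun t => complex.Re (f t)) _ fr).
exact: (@is_derive_snd p v (fun t => complex.Im (f t)) _ fi).
Qed.

Lemma differentiable_coord1 p j : differentiable (fun q : E => q.1 0 j) p.
Proof.
pose f (q : E) : R := q.1 0 j.
have flin : linear f by move=> a u v; rewrite /f /= !mxE.
pose fM := GRing.isLinear.Build _ _ _ _ _ flin.
pose fL : {linear E -> R} := HB.pack f fM.
apply: (@linear_differentiable _ _ _ fL) => q.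
by apply: (cvg_comp fst (fun M : 'rV[R]_n => M 0 j)); [exact: cvg_fst|exact: coord_continuous].
Qed.

Lemma differentiable_coord2 p : differentiable (fun q : E => q.2) p.
Proof.
pose f (q : E) : R := q.2.
have flin : linear f by [].
pose fM := GRing.isLinear.Build _ _ _ _ _ flin.
pose fL : {linear E -> R} := HB.pack f fM.
by apply: (@linear_differentiable _ _ _ fL) => q; exact: cvg_snd.
Qed.

End ProductSpace.


Section Curves.
Context {R : realType}.

Lemma smooth_is_cderive (A : set R) (f : R -> R[i]) s : csmooth_on A f -> A s ->
  is_cderive s 1 f (cderive f s 1).
Proof.
move=> [fr fi] As; have [dr _] := fr 1%N; have [di _] := fi 1%N.
by split; apply: derivableP; apply: diff_derivable; [exact: dr|exact: di].
Qed.

(** [expi] does not depend on the choice of a lift, so any lift near s will do. *)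
Lemma is_cderive_expi k (theta : R -> angle R k) s d : is_angle_derive theta s d ->
  is_cderive s 1 (fun t => expi (theta t)) ('i * d%:C * expi (theta s)).
Proof.
move=> [l [tl dl]].
have tE : \forall t \near s, cos (l t) +i* sin (l t) = expi (theta t).
  by apply: filterS tl => t ->; rewrite expi_angle_pi.
rewrite -(nbhs_singleton tE); apply: near_eq_is_cderive tE _; split => /=.
  apply: is_derive_eq (is_derive1_comp (is_derive_cos (l s)) dl) _.
  by ring.
apply: is_derive_eq (is_derive1_comp (is_derive_sin (l s)) dl) _.
by ring.
Qed.

Lemma expi_conj k (t : angle R k) : expi t * conjc (expi t) = 1.
Proof. by rewrite mul_conj /normsq /= cos2Dsin2. Qed.

Lemma expi_neq0 k (t : angle R k) : expi t != 0.
Proof.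
by apply/eqP => t0; have /eqP := expi_conj t; rewrite t0 mul0r eq_sym oner_eq0.
Qed.

End Curves.

(** * Smooth functions *)

Section SmoothFunctions.
Context {R : realType} {V : normedModType R}.
Implicit Types (A : set V) (f g : V -> R).

Lemma differentiable_near0 f p : (\forall q \near p, f q = 0) -> differentiable f p.
Proof.
move=> f0; have fp : f p = 0 := nbhs_singleton f0.
have f0' : \forall h \near (0 : V), f (h + p) = 0.
  by have := f0; rewrite (near_shift 0 p) subr0.
have lo : f \o shift p = cst (f p) + (0 : V -> R) +o_ (nbhs (0 : V)) id.
  apply/eqaddoP => _/posnumP[e]; near=> h.
  rewrite -[X in `|X|]/(f (h + p) - (f p + 0)) fp addr0 subr0.
  have -> : f (h + p) = 0 by near: h; exact: f0'.
  by rewrite normr0 mulr_ge0.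
have c0 : continuous (0 : V -> R) by move=> q; exact: cvg_cst.
have d0 := diff_unique (df := \0 : {linear V -> R}) c0 lo.
by apply/diff_locallyP; rewrite d0.
Unshelve. all: by end_near. Qed.

Lemma near_eq_differentiable f g p : (\forall q \near p, f q = g q) ->
  differentiable f p -> differentiable g p.
Proof.
move=> fg df; rewrite (_ : g = f + (g - f)); last by apply/funext => q /=; rewrite addrC subrK.
apply: differentiableD => //; apply: differentiable_near0.
by apply: filterS fg => q h; rewrite /= -[LHS]/(g q - f q) h subrr.
Qed.

(** The Leibniz rule for D_v (f * g) holds on A only, so the inductions on the
    order of differentiability need to change functions outside A. *)
Lemma Ck_on_ext A k f g : open A -> (forall p, A p -> f p = g p) ->
  Ck_on A k f -> Ck_on A k g.
Proof.
move=> oA; elim: k f g => [|k IH] f g fg.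
  move=> cf p Ap; have nA : nbhs p A := open_nbhs_nbhs (conj oA Ap).
  rewrite /prop_for /continuous_at -(fg p Ap); apply: cvg_trans (cf p Ap).
  by apply: near_eq_cvg; apply: filterS nA => q /fg.
case=> df Df; split=> [p Ap|v]; have nA q : A q -> nbhs q A by move=> Aq; exact: open_nbhs_nbhs.
  by apply: near_eq_differentiable (df p Ap); apply: filterS (nA p Ap) => q /fg.
apply: IH (Df v) => p Ap; apply: near_eq_derive.
by apply: filterS (nA p Ap) => q /fg.
Qed.

Lemma Ck_on_cst A k (c : R) : Ck_on A k (cst c).
Proof.
elim: k c => [|k IH] c; first by move=> p _; exact: cvg_cst.
split=> [p _|v]; first exact: differentiable_cst.
by rewrite (_ : (fun p => _) = cst 0) //; apply/funext => p; rewrite derive_cst.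
Qed.

Lemma Ck_onW A k f : Ck_on A k.+1 f -> Ck_on A k f.
Proof.
elim: k f => [|k IH] f [df Df]; first by move=> p Ap; exact: differentiable_continuous (df p Ap).
by split=> // v; apply: IH.
Qed.

Lemma Ck_onD A k f g : open A -> Ck_on A k f -> Ck_on A k g -> Ck_on A k (f + g).
Proof.
move=> oA; elim: k f g => [|k IH] f g.
  by move=> cf cg p Ap; apply: cvgD; [exact: cf|exact: cg].
case=> df Df [dg Dg]; split=> [p Ap|v].
  by apply: differentiableD; [exact: df|exact: dg].
apply: Ck_on_ext (IH _ _ (Df v) (Dg v)) => // p Ap.
by rewrite deriveD //; apply: diff_derivable; [exact: df|exact: dg].
Qed.

Lemma Ck_onM A k f g : open A -> Ck_on A k f -> Ck_on A k g -> Ck_on A k (f * g).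
Proof.
move=> oA; elim: k f g => [|k IH] f g.
  by move=> cf cg p Ap; apply: cvgM; [exact: cf|exact: cg].
move=> cf cg; have [df Df] := cf; have [dg Dg] := cg; split=> [p Ap|v].
  by apply: differentiableM; [exact: df|exact: dg].
have h := Ck_onD oA (IH _ _ (Ck_onW cf) (Dg v)) (IH _ _ (Ck_onW cg) (Df v)).
apply: Ck_on_ext h => // p Ap.
by rewrite deriveM //; apply: diff_derivable; [exact: df|exact: dg].
Qed.

Lemma smooth_cst A (c : R) : smooth_on A (cst c).
Proof. by move=> k; exact: Ck_on_cst. Qed.

Lemma smoothD A f g : open A -> smooth_on A f -> smooth_on A g -> smooth_on A (f + g).
Proof. by move=> oA sf sg k; exact: Ck_onD. Qed.

Lemma smoothM A f g : open A -> smooth_on A f -> smooth_on A g -> smooth_on A (f * g).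
Proof. by move=> oA sf sg k; exact: Ck_onM. Qed.

Lemma smooth_sum A m (f : 'I_m -> V -> R) : open A ->
  (forall j, smooth_on A (f j)) -> smooth_on A (\sum_j f j).
Proof.
move=> oA sf; apply: big_ind => //; first exact: smooth_cst.
by move=> g h; exact: smoothD.
Qed.

End SmoothFunctions.

Section SmoothCoordinates.
Context {R : realType} {n : nat}.
Local Notation E := ('rV[R]_n * R)%type.

Lemma smooth_coord (A : set E) j : smooth_on A (fun q : E => q.1 0 j).
Proof.
case=> [p _|k]; first exact: differentiable_continuous (differentiable_coord1 _ _).
split=> [p _|v]; first exact: differentiable_coord1.
rewrite (_ : (fun p => _) = cst (v.1 0 j)); first exact: Ck_on_cst.
by apply/funext => p; have [_] := is_derive_coord p v j.
Qed.

Lemma open_snd (I : set R) : open I -> open [set p : E | I p.2].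
Proof.
move=> oI; rewrite openE => p /= Ip.
exact: (cvg_snd (open_nbhs_nbhs (conj oI Ip))).
Qed.

Lemma smooth_snd (I : set R) (f : R -> R) : open I -> smooth_on I f ->
  smooth_on [set p : E | I p.2] (fun q => f q.2).
Proof.
move=> oI sf k; move: (sf k) => {sf}; elim: k f => [|k IH] f.
  move=> cf p Ip; apply: (cvg_comp snd f); last exact: cf Ip.
  exact: cvg_snd.
case=> df Df; split=> [p Ip|v].
  exact: (differentiable_comp (differentiable_coord2 p) (df _ Ip)).
have oA := open_snd oI.
apply: Ck_on_ext (Ck_onM oA (Ck_on_cst _ k v.2) (IH _ (Df 1))) => // p Ip.
have fd : is_derive p.2 1 f ('D_1 f p.2).
  by apply: derivableP; apply: diff_derivable; exact: df.
by have [_ ->] := is_derive_snd v fd.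
Qed.

End SmoothCoordinates.

Section DifferentiableDet.
Context {R : realType} {V : normedModType R}.

Lemma differentiable_bigsum (J : Type) (s : seq J) (f : J -> V -> R) p :
  (forall j, differentiable (f j) p) ->
  differentiable (fun q => \sum_(j <- s) f j q) p.
Proof.
move=> df; elim: s => [|a s IH].
  by under [X in differentiable X _]funext do rewrite big_nil; exact: differentiable_cst.
under [X in differentiable X _]funext do rewrite big_cons.
exact: differentiableD.
Qed.

Lemma differentiable_bigprod (J : Type) (s : seq J) (f : J -> V -> R) p :
  (forall j, differentiable (f j) p) ->
  differentiable (fun q => \prod_(j <- s) f j q) p.
Proof.
move=> df; elim: s => [|a s IH].
  by under [X in differentiable X _]funext do rewrite big_nil; exact: differentiable_cst.
under [X in differentiable X _]funext do rewrite big_cons.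
exact: differentiableM.
Qed.

Lemma differentiable_det m (M : V -> 'M[R]_m) p :
  (forall i j, differentiable (fun q => M q i j) p) ->
  differentiable (fun q => \det (M q)) p.
Proof.
move=> dM; apply: differentiable_bigsum => s.
apply: differentiableM; first exact: differentiable_cst.
by apply: differentiable_bigprod => i; exact: dM.
Qed.

End DifferentiableDet.

(** * Angle functions with zero derivative *)

Section AngleConstancy.
Context {R : realType}.

(** Let y in [0, 2 pi) be a - b modulo 2 pi.  Then 1 = cos y =
    1 - 2 sin^2 (y / 2), and sin is positive on (0, pi), so y = 0. *)
Lemma eq_cos_sin_eqmod2pi (a b : R) : cos a = cos b -> sin a = sin b -> eqmod2pi a b.
Proof.
move=> cab sab; have p2 : 0 < 2 * pi :> R by rewrite mulr_gt0 // pi_gt0.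
pose m := Num.floor ((a - b) / (2 * pi)).
pose y := a - b - m%:~R * (2 * pi).
have y_ge0 : 0 <= y by rewrite subr_ge0 -ler_pdivlMr // Num.Theory.floor_le.
have y_lt : y < 2 * pi.
  have : a - b < (m%:~R + 1) * (2 * pi).
    by rewrite -ltr_pdivrMr // -[1]/(1%:~R) -intrD; exact: Num.Theory.floorD1_gt.
  by rewrite /y; lra.
have cy : cos y = 1.
  have : eqmod2pi (a - b) y by apply/asboolP; exists m; rewrite /y opprB addrC subrK.
  case/cos_sin_eqmod2pi => <- _; rewrite cosB cab sab -!expr2.
  exact: cos2Dsin2.
suff y0 : y = 0 by apply/asboolP; exists m; apply/eqP; rewrite -subr_eq0 -/y y0.
apply/eqP; rewrite eq_le y_ge0 andbT leNgt; apply/negP => y_gt0.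
have s_gt0 : 0 < sin (y / 2).
  by apply: sin_gt0_pi; rewrite divr_gt0 //= ltr_pdivrMr // mulrC.
have := cosD (y / 2) (y / 2); rewrite -splitr cy.
have := cos2Dsin2 (y / 2); nra.
Qed.

Lemma is_derive0_cst_on (I : set R) (f : R -> R) : is_interval I ->
  (forall t, I t -> is_derive t 1 f 0) -> forall s t, I s -> I t -> f s = f t.
Proof.
move=> itvI df.
suff lt_cst s t : s < t -> I s -> I t -> f s = f t.
  move=> s t Is It; have [st|st|->//] := ltgtP s t; first exact: lt_cst.
  by apply/esym; exact: lt_cst.
move=> st Is It.
have sub x : x \in `[s, t] -> I x by rewrite in_itv /= => h; exact: itvI Is It _ h.
have [||c _] := @MVT_segment _ f (fun=> 0) s t (ltW st).
- by move=> x xst; apply: df; apply: sub; apply: subset_itv_oo_cc xst.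
- apply: derivable_within_continuous => x xst.
  by have [] := df x (sub x xst).
by rewrite mul0r => /eqP; rewrite subr_eq0 => /eqP.
Qed.

(** Modulo 2 pi the hypothesis speaks of a separate lift near each point, but
    e^(i theta) is defined on all of I and determines theta. *)
Lemma angle_derive0_cst k (theta : R -> angle R k) (I : set R) : is_interval I ->
  (forall s, I s -> is_angle_derive theta s 0) ->
  forall s t, I s -> I t -> theta s = theta t.
Proof.
move=> itvI dth; case: k theta dth => theta dth.
  apply: is_derive0_cst_on => // t It; have [l [tl dl]] := dth t It.
  by apply: near_eq_is_derive dl; apply: filterS tl => q ->.
move=> s t Is It.
have d0 u : I u -> is_cderive u 1 (fun v => expi (theta v)) 0.
  move=> Iu; apply: is_cderive_eq (is_cderive_expi (dth u Iu)) _.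
  by rewrite mulr0 mul0r.
rewrite -(reprK (theta s)) -(reprK (theta t)); apply/eqquotP.
apply: eq_cos_sin_eqmod2pi.
- have := is_derive0_cst_on itvI (f := fun v => complex.Re (expi (theta v))).
  by apply => // u Iu; have [] := d0 u Iu.
- have := is_derive0_cst_on itvI (f := fun v => complex.Im (expi (theta v))).
  by apply => // u Iu; have [] := d0 u Iu.
Qed.

End AngleConstancy.

(** * Geometry of the family of quadrics *)

Section Family.
Context {R : realType} {n : nat}.
Variables (lambda : 'I_n -> R) (C alpha : R).
Hypotheses (lambda_neq0 : forall j, lambda j != 0) (C_neq0 : C != 0).
Variables (I : set R) (k : angle_kind) (theta : R -> angle R k) (w : 'I_n -> R -> R[i]).
Hypothesis I_open : open I.
Hypothesis w_smooth : forall j, csmooth_on I (w j).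
Hypothesis w_neq0 : forall j s, I s -> w j s != 0.
Hypothesis w_ode : forall j s, I s ->
  cderive (w j) s 1 =
  (lambda j)%:C * expi (theta s) * conjc (\prod_(i | i != j) w i s).
Hypothesis theta_ode : forall s, I s ->
  is_angle_derive theta s (alpha * complex.Im ((expi (theta s))^-1 * \prod_j w j s)).

Local Notation E := ('rV[R]_n * R)%type.
Local Notation L := (quadric_family lambda C I w).
Implicit Types (p q u v : E).

(** The common factor Q of the velocities. *)
Definition phase s : R[i] := expi (theta s) * conjc (\prod_j w j s).

Local Notation x p := (fun j => p.1 0 j).
Local Notation W s := (fun j => w j s).
Local Notation dFp p := (dF lambda (x p) (W p.2) (phase p.2)).
Local Notation conormalp p := (conormal lambda (x p)).
Local Notation vel s := (velocity lambda (W s) (phase s)).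
Local Notation acc s := (acceleration lambda (W s) (phase s) (- (alpha * complex.Im (phase s)))).

Lemma phase_neq0 s : I s -> phase s != 0.
Proof.
move=> Is; rewrite mulf_neq0 ?expi_neq0 // conjc_eq0.
by apply/prodf_neq0 => j _; exact: w_neq0.
Qed.

Lemma velocity_ode s j : I s ->
  vel s j = (lambda j)%:C * expi (theta s) * conjc (\prod_(i | i != j) w i s).
Proof.
move=> Is; rewrite /velocity /phase (bigD1 j) //= rmorphM /=.
have : conjc (w j s) != 0 by rewrite conjc_eq0 w_neq0.
by move: (conjc _) => z z0; field.
Qed.

Lemma is_cderive_w s j : I s -> is_cderive s 1 (w j) (vel s j).
Proof.
by move=> Is; rewrite velocity_ode // -w_ode //; exact: smooth_is_cderive Is.
Qed.

(** e^(-i theta) w_1 ... w_n is the conjugate of Q, hence the sign. *)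
Lemma angle_rate s : I s ->
  is_angle_derive theta s (- (alpha * complex.Im (phase s))).
Proof.
move=> Is; have := theta_ode Is.
have -> : (expi (theta s))^-1 = conjc (expi (theta s)).
  by apply: (mulfI (expi_neq0 (theta s))); rewrite divff ?expi_neq0 // expi_conj.
rewrite -[X in conjc _ * X]conjcK -rmorphM /= -/(phase s) Im_conjc.
by rewrite mulrN.
Qed.

Lemma is_cderive_velocity s j : I s ->
  is_cderive s 1 (fun t => vel t j) (acc s j).
Proof.
move=> Is.
apply: (near_eq_is_cderive (f := fun t => (lambda j)%:C *
    (expi (theta t) * conjc (\prod_(i | i != j) w i t)))).
  apply: filterS (open_nbhs_nbhs (conj I_open Is)) => t It.
  by rewrite velocity_ode // mulrA.
apply: is_cderive_eq.
  apply: is_cderiveM; first exact: is_cderive_cst.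
  apply: is_cderiveM; first exact: is_cderive_expi (angle_rate Is).
  apply: is_cderive_conj; apply: is_cderive_prod => i; first exact: w_neq0.
  exact: is_cderive_w.
rewrite /acceleration velocity_ode // mul0r add0r rmorphM /=.
have -> : conjc (\sum_(i | i != j) vel s i / w i s) =
    conjc (phase s) * (log_rate lambda (W s) - lambda j / normsq (w j s))%:C.
  rewrite /log_rate [in RHS](bigD1 j) //= addrAC subrr add0r !rmorph_sum mulr_sumr.
  apply: eq_bigr => i _; rewrite velocityE => [|l]; last exact: w_neq0.
  by rewrite mulfK ?w_neq0 // [LHS]rmorphM [X in X * _]conjc_real mulrC.
by ring.
Qed.

Lemma is_cderive_pos p u j : I p.2 ->
  is_cderive p u (fun q => pos L q 0 j) (dFp p u 0 j).
Proof.
move=> Ip.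
under [X in is_cderive _ _ X]funext do rewrite mxE.
apply: is_cderive_eq.
  apply: is_cderiveM.
    apply: is_cderive_real; exact: is_derive_coord.
  apply: is_cderive_snd; exact: is_cderive_w.
by rewrite !mxE rmorphM /=; ring.
Qed.

Lemma dposE p u : I p.2 -> dpos L p u = dFp p u.
Proof.
move=> Ip; apply/rowP => j; rewrite mxE.
by rewrite (is_cderive_val (is_cderive_pos u j Ip)).
Qed.

Lemma posE p : pos L p = position (x p) (W p.2).
Proof. by []. Qed.

Lemma is_derive_eqn p u : is_derive p u (Defs.eqn L) (2 * conormalp p u).
Proof.
have sq j : is_derive p u (fun q : E => lambda j * q.1 0 j ^+ 2)
    (2 * (lambda j * p.1 0 j * u.1 0 j)).
  have dj := is_derive_coord p u j.
  by apply: is_derive_eq; rewrite /GRing.scale /=; ring.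
have -> : Defs.eqn L = (\sum_j (fun q : E => lambda j * q.1 0 j ^+ 2)) - cst C.
  by apply/funext => q; rewrite -[RHS]/((\sum_j (fun q : E => _)) q - C) fct_sumE.
by apply: is_derive_eq; rewrite subr0 -mulr_sumr.
Qed.

Lemma eqn_derive p u : 'D_u (Defs.eqn L) p = 2 * conormalp p u.
Proof. by have [_] := is_derive_eqn p u. Qed.

Lemma tangentE p u : tangent L p u <-> conormalp p u = 0.
Proof.
rewrite /tangent eqn_derive; split => [/eqP|->]; last by rewrite mulr0.
by rewrite mulf_eq0 pnatr_eq0 /= => /eqP.
Qed.

Lemma pointsP p : points L p -> I p.2 /\ \sum_j lambda j * p.1 0 j ^+ 2 = C.
Proof. by move=> [Ip /eqP]; rewrite /= subr_eq0 => /eqP. Qed.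

Lemma near_dom p : I p.2 -> \forall q \near p, I q.2.
Proof.
by move=> Ip; apply: (cvg_snd (open_nbhs_nbhs (conj I_open Ip))).
Qed.

Section AtPoint.
Variable p : E.
Hypothesis p_L : points L p.

Let Ip : I p.2. Proof. by have [] := pointsP p_L. Qed.
Let xC : \sum_j lambda j * p.1 0 j ^+ 2 = C. Proof. by have [] := pointsP p_L. Qed.
Let wp_neq0 j : w j p.2 != 0. Proof. exact: w_neq0. Qed.
Let Qp_neq0 : phase p.2 != 0. Proof. exact: phase_neq0. Qed.

Lemma normal_part_exists z : exists y, is_normal_part L p z y.
Proof.
have [t t0 ht] := tangential_part wp_neq0 C_neq0 lambda_neq0 Qp_neq0 xC z.
exists (z - dFp p t); split; last first.
  by exists t; split; [exact/tangentE|rewrite dposE // subrK].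
move=> u /tangentE u0; rewrite dposE // -Re_hdot hdotBl !reimE ht //.
by rewrite (hdot_dF _ wp_neq0 t0 u0) subrr.
Qed.

(** Two normal parts differ by a vector that is both normal and tangent, hence
    of zero length. *)
Lemma normal_part_unique z y y' :
  is_normal_part L p z y -> is_normal_part L p z y' -> y = y'.
Proof.
move=> [yn [u [/tangentE u0 zu]]] [yn' [u' [/tangentE u0' zu']]].
move: zu zu' yn yn'; rewrite !dposE // => -> h yn yn'.
have v0 : conormalp p (u' - u) = 0.
  by rewrite conormalB u0 u0' subrr.
have yE : y - y' = dFp p (u' - u).
  by rewrite dFB; apply/eqP; rewrite subr_eq addrAC [X in X - _]addrC -h addrK.
have := hdot_dF (phase p.2) wp_neq0 v0 v0; rewrite -{1}yE => /(congr1 (@complex.Re R)).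
rewrite hdotBl !reimE !Re_hdot -!dposE // yn; last exact/tangentE.
rewrite yn'; last exact/tangentE.
rewrite subrr => /esym/(metric_eq0 wp_neq0 C_neq0 lambda_neq0 Qp_neq0 xC) v00.
by apply/eqP; rewrite -subr_eq0 yE v00 dF0.
Qed.

Lemma normal_partP z : is_normal_part L p z (normal_part L p z).
Proof. exact: xgetPex (normal_part_exists z). Qed.

Lemma Re_hdot_normal z t : conormalp p t = 0 ->
  complex.Re (hdot (normal_part L p z) (dFp p t)) = 0.
Proof.
move=> t0; have [h _] := normal_partP z.
by rewrite Re_hdot -dposE // h //; exact/tangentE.
Qed.

(** The tangential component has real products with tangent vectors, so removing
    it leaves the imaginary part unchanged. *)
Lemma Im_hdot_normal z t : conormalp p t = 0 ->
  complex.Im (hdot (normal_part L p z) (dFp p t)) = complex.Im (hdot z (dFp p t)).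
Proof.
move=> t0; have [_ [u [/tangentE u0 zE]]] := normal_partP z.
rewrite [in RHS]zE hdotDl dposE // (hdot_dF _ wp_neq0 u0 t0) !reimE.
by rewrite addr0.
Qed.

Lemma normal_part_tangent z u : conormalp p u = 0 ->
  normal_part L p (z + dFp p u) = normal_part L p z.
Proof.
move=> u0; apply: normal_part_unique (normal_partP _) _.
have [yn [v [/tangentE v0 zE]]] := normal_partP z.
split=> //; exists (v + u); split.
  by apply/tangentE; rewrite conormalD u0 v0 addr0.
by rewrite [in LHS]zE !dposE // dFD addrA.
Qed.

Lemma gramE e : (forall i, conormalp p (e i) = 0) ->
  gram L p e = metric_mx lambda (x p) (W p.2) (phase p.2) e.
Proof.
move=> e0; apply/matrixP => i j; rewrite !mxE -Re_hdot !dposE //.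
by rewrite (hdot_dF _ wp_neq0 (e0 i) (e0 j)).
Qed.

(** The derivative of sum_j lambda_j x_j V_j = 0 in the direction u.  That
    identity holds on the level set only, so it is differentiated along a curve
    in the level set with velocity u. *)
Lemma tangent_field_derive (V : E -> E) u : differentiable V p ->
  (\forall q \near p, points L q -> tangent L q (V q)) -> tangent L p u ->
  \sum_j lambda j * p.1 0 j * 'D_u (fun q => (V q).1 0 j) p
    = - qform lambda u (V p).
Proof.
move=> dV tV /tangentE u0.
have dVj j : differentiable (fun q => (V q).1 0 j) p.
  exact: (differentiable_comp dV (differentiable_coord1 _ j)).
pose phi q := conormalp q (V q).
have phiE : phi = \sum_j (fun q : E => lambda j * (q.1 0 j * (V q).1 0 j)).
  by apply/funext => q; rewrite fct_sumE; apply: eq_bigr => j _; rewrite mulrA.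
have dphi : differentiable phi p.
  rewrite phiE; apply: differentiable_sum => j.
  apply: differentiableM; first exact: differentiable_cst.
  by apply: differentiableM => //; exact: differentiable_coord1.
have phi' : 'D_u phi p = \sum_j (lambda j * p.1 0 j * 'D_u (fun q => (V q).1 0 j) p
    + lambda j * u.1 0 j * (V p).1 0 j).
  rewrite phiE; apply: derive_val; apply: is_derive_sum => j.
  have d1 := is_derive_coord p u j.
  have d2 := derivableP (diff_derivable (v := u) (dVj j)).
  by apply: is_derive_eq; rewrite /GRing.scale /=; ring.
(* The line through - x with direction 2 x + h u meets the quadric again at
   - x + tau (2 x + h u), and at h = 0 this point is x: a rational curve. *)
pose kappa := \sum_j lambda j * u.1 0 j ^+ 2.
pose tau (h : R) := 4 * C / (4 * C + h ^+ 2 * kappa).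
pose c (h : R) : E := (2 * tau h - 1) *: (p.1, 0) + (h * tau h) *: (u.1, 0)
  + h *: (0, u.2) + (0, p.2).
have C4 : 4 * C != 0 by rewrite mulf_neq0 ?pnatr_eq0.
have tau0 : tau 0 = 1 by rewrite /tau expr0n mul0r addr0 divff.
have dden : is_derive (0 : R) 1 (fun h => 4 * C + h ^+ 2 * kappa) 0.
  by apply: is_derive_eq; rewrite /GRing.scale /=; ring.
have den0 : 4 * C + 0 ^+ 2 * kappa != 0 by rewrite expr0n mul0r addr0.
have dtau : is_derive (0 : R) 1 tau 0.
  have dinv : is_derive (0 : R) 1 (fun h => (4 * C + h ^+ 2 * kappa)^-1) 0.
    apply: DeriveDef; first exact: derivableV.
    by rewrite deriveV // derive_val scaler0.
  by apply: is_derive_eq; rewrite /GRing.scale /=; ring.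
have dc : is_derive (0 : R) 1 c u.
  have d1 : is_derive (0 : R) 1 (fun h => 2 * tau h - 1) 0.
    by apply: is_derive_eq; rewrite /GRing.scale /=; ring.
  have d2 : is_derive (0 : R) 1 (fun h => h * tau h) 1.
    by apply: is_derive_eq; rewrite /GRing.scale /= tau0; ring.
  have d3 : is_derive (0 : R) 1 (fun h : R => h) 1 by exact: is_derive_id.
  have d := is_deriveD (is_deriveD (is_deriveD (is_derive_scale (p.1, 0 : R) d1)
    (is_derive_scale (u.1, 0 : R) d2)) (is_derive_scale (0 : 'rV[R]_n, u.2) d3))
    (is_derive_cst (0 : 'rV[R]_n, p.2) (0 : R) 1).
  apply: is_derive_eq d _.
  rewrite scale0r add0r addr0 !scale1r; case: (u) => a b.
  by congr (_, _) => /=; rewrite ?addr0 ?add0r.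
have c0 : c 0 = p.
  rewrite /c tau0 mulr1 mul0r !scale0r !addr0 [2]/(1 + 1) addrK scale1r.
  by case: (p) => a b; congr (_, _) => /=; rewrite ?addr0 ?add0r.
have dfc : differentiable c 0 by apply/derivable1_diffP; case: dc.
suff : 'D_u phi p = 0.
  rewrite phi' big_split /= => /eqP; rewrite addr_eq0 => /eqP ->; congr (- _).
have cu : 'd c 0 1 = u by rewrite -deriveE //; case: dc.
rewrite -(derive_curve c0 dfc cu dphi).
rewrite (@near_eq_derive _ _ _ _ (cst 0)) ?derive_cst //.
have cc : c @ (0 : R) --> c 0 by exact: differentiable_continuous dfc.
rewrite c0 in cc.
have dfd : differentiable (fun h : R => 4 * C + h ^+ 2 * kappa) 0.
  by apply/derivable1_diffP; case: dden.
have denc := differentiable_continuous dfd : _ @ _ --> _.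
have near_den := cvgr_neq0 _ denc den0.
have near_tan := cc _ tV.
have near_I := cc _ (near_dom Ip).
near=> h; have hden : 4 * C + h ^+ 2 * kappa != 0 by near: h; exact: near_den.
have hI : I (c h).2 by near: h; exact: near_I.
have hT : points L (c h) -> tangent L (c h) (V (c h)) by near: h; exact: near_tan.
rewrite /= /phi; apply/tangentE/hT; split; first exact: hI.
have cE j : (c h).1 0 j = (2 * tau h - 1) * p.1 0 j + h * tau h * u.1 0 j.
  by rewrite /= !mxE mulr0 !addr0.
rewrite /=; under eq_bigr do rewrite cE.
transitivity ((2 * tau h - 1) ^+ 2 * (\sum_j lambda j * p.1 0 j ^+ 2)
  + 2 * (2 * tau h - 1) * (h * tau h) * conormalp p u + (h * tau h) ^+ 2 * kappa - C).
  congr (_ - _); rewrite /kappa /conormal !mulr_sumr -!big_split.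
  by apply: eq_bigr => j _; rewrite /=; ring.
rewrite u0 xC /tau; field; exact: hden.
Unshelve. all: by end_near. Qed.

Lemma is_cderive_dpos (V : E -> E) u j : differentiable V p ->
  is_cderive p u (fun q => dpos L q (V q) 0 j)
    ((hessian lambda (x p) (W p.2) (phase p.2) (- (alpha * complex.Im (phase p.2))) u (V p)
      + dFp p (\row_l 'D_u (fun q => (V q).1 0 l) p, 'D_u (fun q => (V q).2) p)) 0 j).
Proof.
move=> dV.
have dV1 : is_derive p u (fun q => (V q).1 0 j) ('D_u (fun q => (V q).1 0 j) p).
  apply/derivableP/diff_derivable.
  exact: (differentiable_comp dV (differentiable_coord1 _ j)).
have dV2 : is_derive p u (fun q => (V q).2) ('D_u (fun q => (V q).2) p).
  apply/derivableP/diff_derivable.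
  exact: (differentiable_comp dV (differentiable_coord2 _)).
apply: (near_eq_is_cderive (f := fun q : E => ((V q).1 0 j)%:C * w j q.2
    + (q.1 0 j * (V q).2)%:C * vel q.2 j)).
  by apply: filterS (near_dom Ip) => q Iq; rewrite dposE // mxE.
have wd := is_cderive_snd u (is_cderive_w j Ip).
have veld := is_cderive_snd u (is_cderive_velocity j Ip).
have xd := is_deriveM (is_derive_coord p u j) dV2.
apply: is_cderive_eq (is_cderiveD (is_cderiveM (is_cderive_real dV1) wd)
  (is_cderiveM (is_cderive_real xd) veld)) _.
rewrite !mxE /= /GRing.scale /= !(rmorphD, rmorphM) /=; ring.
Qed.

(** The derivative of the pushed-forward field is the second derivative of the
    position map plus dF of the derivative D of the field; by
    [tangent_field_derive], D + [qform] u (V p) / C (x, 0) is tangent. *)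
Lemma second_formE (V : E -> E) u : differentiable V p ->
  (\forall q \near p, points L q -> tangent L q (V q)) -> tangent L p u ->
  second_form L p u V = normal_part L p (normal_acceleration lambda (x p) (W p.2) (phase p.2) C
    (- (alpha * complex.Im (phase p.2))) u (V p)).
Proof.
move=> dV tV tu; rewrite /second_form.
set D : E := (\row_l 'D_u (fun q => (V q).1 0 l) p, 'D_u (fun q => (V q).2) p).
pose c := qform lambda u (V p) / C.
have cD : conormalp p (D + c *: (p.1, 0)) = 0.
  rewrite conormalD conormalZ.
  have -> : conormalp p (p.1, 0) = C.
    by rewrite -xC; apply: eq_bigr => j _; rewrite /= -mulrA -expr2.
  have -> : conormalp p D = - qform lambda u (V p).
    by rewrite -(tangent_field_derive dV tV tu); apply: eq_bigr => j _; rewrite mxE.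
  by rewrite /c divfK // addNr.
rewrite -[RHS](normal_part_tangent _ cD); congr (normal_part L p _).
apply/rowP => j; rewrite [LHS]mxE (is_cderive_val (is_cderive_dpos u j dV)).
rewrite -/D dFD dFZ /normal_acceleration.
have -> : dFp p (p.1, 0) = position (x p) (W p.2).
  by apply/rowP => l; rewrite !mxE /= mulr0 mul0r addr0.
by rewrite -/c !mxE; ring.
Qed.

(** Both sides are normal, and their products with each frame vector t have the
    same imaginary part theta' t_s = - alpha (Im Q) t_s; [hdot_dF_eq0]
    concludes. *)
Lemma frame_mean_curvatureE (V : 'I_n -> E -> E) : local_frame L p V ->
  frame_mean_curvature L p V = (alpha / C)%:C *: normal_part L p (pos L p).
Proof.
move=> [dV bV]; pose e i := V i p.
have [eT e_free] := nbhs_singleton bV p_L.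
have e0 i : conormalp p (e i) = 0 by exact: (proj1 (tangentE p (e i)) (eT i)).
rewrite /frame_mean_curvature -/e (gramE e0) posE; apply/eqP; rewrite -subr_eq0; apply/eqP.
apply: (hdot_dF_eq0 wp_neq0 C_neq0 lambda_neq0 Qp_neq0 xC e0 e_free) => m.
pose d := - (alpha * complex.Im (phase p.2)).
have sfE i j : second_form L p (V i p) (V j) = normal_part L p
    (normal_acceleration lambda (x p) (W p.2) (phase p.2) C d (e i) (e j)).
  apply: second_formE (dV j) _ (eT i).
  by apply: filterS bV => q h Lq; exact: (proj1 (h Lq) j).
under eq_bigr => i _ do under eq_bigr => j _ do rewrite sfE.
rewrite hdotBl hdotZl hdot_suml.
under eq_bigr => i _ do (rewrite hdot_suml; under eq_bigr => j _ do rewrite hdotZl).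
apply: complex_eq; rewrite /= !reimE /= ?mul0r ?subr0 ?addr0.
  rewrite Re_hdot_normal // mulr0 subr0 Re_sum big1 // => i _.
  by rewrite Re_sum big1 // => j _; rewrite !reimE Re_hdot_normal //= mul0r mulr0 subr0.
rewrite Im_hdot_normal // (Im_hdot_position _ wp_neq0 xC).
rewrite Im_sum (_ : \sum_i _ = d * (e m).2).
  by rewrite /d; field.
rewrite -(trace_normal_acceleration wp_neq0 C_neq0 lambda_neq0 Qp_neq0 xC d e0 e_free (e0 m)).
apply: eq_bigr => i _; rewrite Im_sum; apply: eq_bigr => j _.
by rewrite !reimE Im_hdot_normal //= mul0r addr0.
Qed.

(** As C <> 0, some coordinate x_m is nonzero.  The frame consists of d/ds and,
    for i <> m, of the fields lambda_m x_m d/dx_i - lambda_i x_i d/dx_m, which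
    are tangent everywhere and independent where x_m <> 0. *)
Lemma local_frame_exists : exists V, local_frame L p V.
Proof.
have [m xm0] : exists m, p.1 0 m != 0.
  apply: contrapT => /forallNP h; case/eqP: C_neq0; rewrite -xC big1 // => j _.
  by have /negP := h j; rewrite negbK => /eqP ->; rewrite expr0n mulr0.
pose eps i : E := (delta_mx 0 i, 0).
pose V i (q : E) : E := if i == m then (0, 1)
  else (lambda m * q.1 0 m) *: eps i - (lambda i * q.1 0 i) *: eps m.
have ceps q i : conormalp q (eps i) = lambda i * q.1 0 i.
  rewrite /conormal (bigD1 i) //= big1 => [|j ji].
    by rewrite mxE !eqxx mulr1 addr0.
  by rewrite mxE (negPf ji) andbF mulr0.
exists V; split=> [i|].
  rewrite /V; case: eqP => _; first exact: differentiable_cst.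
  by apply: differentiableB; apply: differentiableZl;
    apply: differentiableM; do ?[exact: differentiable_cst|exact: differentiable_coord1].
have near_m : \forall q \near p, (q : E).1 0 m != 0.
  have c1 : (fun q : E => q.1 0 m) @ p --> p.1 0 m.
    exact: (differentiable_continuous (differentiable_coord1 p m)).
  exact: cvgr_neq0 c1 xm0.
apply: filterS near_m => q qm _; split=> [i|a aV].
  apply/tangentE; rewrite /V; case: eqP => _.
    by apply: big1 => j _; rewrite mxE mulr0.
  by rewrite conormalB !conormalZ !ceps mulrC subrr.
have am : a m = 0.
  have := congr1 snd aV; rewrite (big_morph snd (id1 := 0) (op1 := +%R)) //.
  rewrite (bigD1 m) //= big1 => [|i im].
    by rewrite /V eqxx /= addr0 /GRing.scale /= mulr1.
  by rewrite /V (negPf im) /= /GRing.scale /= !mulr0 subr0 mulr0.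
move=> i; have [->//|im] := eqVneq i m.
have fD : {morph (fun u : E => u.1 0 i) : u v / u + v} by move=> u u'; rewrite mxE.
have f0 : (0 : E).1 0 i = 0 by rewrite mxE.
have := congr1 (fun u : E => u.1 0 i) aV; rewrite (big_morph _ fD f0) f0.
rewrite (bigD1 i) //= big1 => [|j ji]; last first.
  rewrite /V; case: eqP => [_|_]; first by rewrite !mxE mulr0.
  by rewrite /= !mxE eqxx [i == j]eq_sym (negPf ji) (negPf im) !mulr0 subr0 mulr0.
rewrite /V (negPf im) /= !mxE !eqxx (negPf im) mulr1 mulr0 subr0 addr0 => /eqP.
by rewrite !mulf_eq0 (negPf (lambda_neq0 m)) (negPf qm) !orbF => /eqP.
Qed.

Lemma position_is_mean_curvature :
  is_mean_curvature L p ((alpha / C)%:C *: normal_part L p (pos L p)).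
Proof. by split; [exact: local_frame_exists|exact: frame_mean_curvatureE]. Qed.

(** By [det_dF_mx] this is, up to a positive factor, e^(-i theta) dz on the basis:
    its sign is the orientation for which theta is the Lagrangian angle. *)
Definition frame_det q (b : 'I_n -> E) : R :=
  \det (frame_mx lambda (x q) (W q.2) b).

Lemma frame_det_neq0 b : tangent_basis L p b -> frame_det p b != 0.
Proof.
move=> [bT b_free].
have b0 i : conormalp p (b i) = 0 by exact: (proj1 (tangentE p (b i)) (bT i)).
exact: (frame_mx_det_neq0 wp_neq0 C_neq0 lambda_neq0 Qp_neq0 xC b0 b_free).
Qed.

Lemma frame_det_mul b (A : 'M[R]_n) :
  frame_det p (fun i => \sum_j A i j *: b j) = \det A * frame_det p b.
Proof.
rewrite -det_mulmx; congr (\det _); apply/matrixP => i l; rewrite !mxE.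
have fD : {morph (fun u : E => u.1 0 l) : u v / u + v} by move=> u u'; rewrite mxE.
have f0 : (0 : E).1 0 l = 0 by rewrite mxE.
rewrite (big_morph _ fD f0) (big_morph snd (id1 := 0) (op1 := +%R)) //.
rewrite mulr_suml -big_split; apply: eq_bigr => j _.
by rewrite !mxE /= /GRing.scale /=; ring.
Qed.

Lemma frame_det_differentiable (V : 'I_n -> E -> E) :
  (forall i, differentiable (V i) p) ->
  differentiable (fun q => frame_det q (fun i => V i q)) p.
Proof.
move=> dV; apply: differentiable_det => i j.
under [X in differentiable X _]funext do rewrite mxE.
have [dr _] := (w_smooth j).1 1%N; have [di _] := (w_smooth j).2 1%N.
have d1 := differentiable_comp (differentiable_coord2 p) (dr _ Ip).
have d2 := differentiable_comp (differentiable_coord2 p) (di _ Ip).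
apply: differentiableD; first exact: differentiable_comp (dV i) (differentiable_coord1 _ j).
apply: differentiableM; first exact: differentiable_comp (dV i) (differentiable_coord2 _).
apply: differentiableM.
  by apply: differentiableM; [exact: differentiable_cst|exact: differentiable_coord1].
apply: differentiableV; last exact: normsq_w_neq0 wp_neq0 j.
exact: differentiableD (differentiableM d1 d1) (differentiableM d2 d2).
Qed.

(** dz is e^(i theta) times the real number |w_1 ... w_n|^2 [frame_det] p b, and
    the square of that number is the Gram determinant by [normsq_det_dF_mx]. *)
Lemma dz_tangent_basis b : tangent_basis L p b -> dz (fun i => dpos L p (b i))
  = expi (theta p.2) * (vol L (fun p b => 0 < frame_det p b) p b)%:C.
Proof.
move=> [bT b_free].
have b0 i : conormalp p (b i) = 0 by exact: (proj1 (tangentE p (b i)) (bT i)).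
rewrite /vol (gramE b0) -(normsq_det_dF_mx _ wp_neq0 b0).
have dzE : dz (fun i => dpos L p (b i)) = \det (dF_mx lambda (x p) (W p.2) (phase p.2) b).
  by congr (\det _); apply/matrixP => i j; rewrite [LHS]mxE [RHS]mxE dposE.
pose W2 := normsq (\prod_j w j p.2).
have phW : phase p.2 * \prod_j w j p.2 = expi (theta p.2) * W2%:C.
  by rewrite /phase -mulrA [conjc _ * _]mulrC mul_conj.
have W2_gt0 : 0 < W2 by apply: normsq_gt0; apply/prodf_neq0 => j _; exact: wp_neq0.
have D0 := frame_det_neq0 (conj bT b_free).
rewrite dzE (det_dF_mx _ wp_neq0 C_neq0 lambda_neq0 xC b0) phW -/(frame_det p b).
move: D0; move: (frame_det p b) => D D0.
have -> : normsq (D%:C * (expi (theta p.2) * W2%:C)) = (D * W2) ^+ 2.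
  rewrite !normsqM !normsq_real (_ : normsq (expi _) = 1) ?mul1r ?exprMn //.
  exact: cos2Dsin2.
rewrite sqrtr_sqr normrM [`|W2|]gtr0_norm // mulrCA; congr (_ * _).
rewrite -rmorphM; congr (_ %:C); rewrite mulrA; congr (_ * _).
have [D_gt0|D_le0] := ltP 0 D; first by rewrite mul1r gtr0_norm.
by rewrite ler0_norm // mulN1r opprK.
Qed.

End AtPoint.

(** The determinant has no zero on tangent bases and is continuous along local
    frames, so its sign is locally constant. *)
Lemma frame_det_orientation : orientation L (fun p b => 0 < frame_det p b).
Proof.
split=> [p b A pL bB|p V pL [dV bV]].
  rewrite unitmxE unitfE frame_det_mul => A0.
  have D0 := frame_det_neq0 pL bB.
  case: (ltrgt0P (\det A)) A0 => [a|a|_] // _; first by rewrite pmulr_rgt0 //; case: (0 < _).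
  rewrite nmulr_rgt0 //; case: (ltrgt0P (frame_det p b)) D0 => //.
have D0 := frame_det_neq0 pL (nbhs_singleton bV pL).
have cD := differentiable_continuous (frame_det_differentiable pL dV) : _ @ _ --> _.
have [D_gt0|D_lt0|D_eq0] := ltrgt0P (frame_det p (fun i => V i p)).
- by apply: filterS (cvgr_gt _ cD _ D_gt0) => q h _; rewrite h.
- apply: filterS (cvgr_lt _ cD _ D_lt0) => q h _.
  by apply/negP => /lt_trans /(_ h); rewrite ltxx.
- by rewrite D_eq0 eqxx in D0.
Qed.

Lemma family_lagrangian : lagrangian L.
Proof.
move=> p u v pL /tangentE u0 /tangentE v0; have [Ip _] := pointsP pL.
apply: oppr_inj; rewrite -Im_hdot !dposE // (hdot_dF _ _ u0 v0) ?oppr0 // => j.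
exact: w_neq0.
Qed.

Lemma family_immersed : immersed L.
Proof.
have oD : open (Defs.dom L) := open_snd I_open.
split=> //.
- have -> : Defs.eqn L = \sum_j (cst (lambda j) * (fun q : E => q.1 0 j)
      * (fun q : E => q.1 0 j)) + cst (- C).
    apply/funext => q.
    rewrite -[RHS]/((\sum_j (cst (lambda j) * (fun q : E => q.1 0 j)
      * (fun q : E => q.1 0 j))) q - C) fct_sumE.
    by congr (_ - _); apply: eq_bigr => j _; rewrite expr2 mulrA.
  apply: smoothD => //; last exact: smooth_cst.
  apply: smooth_sum => // j; apply: smoothM => //; last exact: smooth_coord.
  by apply: smoothM => //; [exact: smooth_cst|exact: smooth_coord].
- move=> j; have [sr si] := w_smooth j; split.
  + have -> : (fun p => complex.Re (pos L p 0 j))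
        = (fun q : E => q.1 0 j) * (fun q : E => complex.Re (w j q.2)).
      by apply/funext => q; rewrite mxE Re_mul /= mul0r subr0.
    by apply: smoothM => //; [exact: smooth_coord|exact: smooth_snd sr].
  + have -> : (fun p => complex.Im (pos L p 0 j))
        = (fun q : E => q.1 0 j) * (fun q : E => complex.Im (w j q.2)).
      by apply/funext => q; rewrite mxE Im_mul /= mul0r addr0.
    by apply: smoothM => //; [exact: smooth_coord|exact: smooth_snd si].
- move=> p pL; have [_ xC] := pointsP pL; exists (p.1, 0).
  rewrite eqn_derive (_ : conormalp p _ = C) ?mulf_neq0 ?pnatr_eq0 //.
  by rewrite -xC; apply: eq_bigr => j _; rewrite /= -mulrA -expr2.
- move=> p u pL /tangentE u0; have [Ip xC] := pointsP pL; rewrite dposE // => du0.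
  apply: (dF_inj _ C_neq0 lambda_neq0 (phase_neq0 Ip) xC u0 du0) => j.
  exact: w_neq0.
Qed.

End Family.

(** * Self-similarity of the family *)

Theorem theoremA (R : realType) (n : nat) (n_ge1 : (1 <= n)%N)
    (lambda : 'I_n -> R) (C alpha : R)
    (lambda_neq0 : forall j, lambda j != 0) (C_neq0 : C != 0)
    (I : set R) (I_open : open I) (I_interval : is_interval I)
    (k : angle_kind) (theta : R -> angle R k) (w : 'I_n -> R -> R[i])
    (theta_smooth : smooth_angle_on I theta)
    (w_smooth : forall j, csmooth_on I (w j))
    (w_neq0 : forall j s, I s -> w j s != 0)
    (w_ode : forall j s, I s ->
       cderive (w j) s 1 =
       (lambda j)%:C * expi (theta s) * conjc (\prod_(i | i != j) w i s))
    (theta_ode : forall s, I s ->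
       is_angle_derive theta s
         (alpha * complex.Im ((expi (theta s))^-1 * \prod_j w j s))) :
  let L := quadric_family lambda C I w in
  [/\ immersed L /\ lagrangian L,
      exists o, orientation L o /\ lagrangian_angle L o (fun p => theta p.2),
      forall p, points L p -> exists H, is_mean_curvature L p H /\
        alpha%:C *: normal_part L p (pos L p) = C%:C *: H,
      (0 < alpha / C -> self_expander L) /\
      (alpha / C < 0 -> self_shrinker L)
    & alpha = 0 ->
      [/\ forall s t, I s -> I t -> theta s = theta t,
          special_lagrangian L
        & forall p, points L p -> is_mean_curvature L p 0]].
Proof.
move=> L.
have imm : immersed L by exact: family_immersed w_ode.
have lag : lagrangian L by exact: family_lagrangian w_ode.
pose o p b := 0 < frame_det lambda w p b.
have ori : orientation L o by exact: (frame_det_orientation lambda_neq0 C_neq0 theta w_smooth w_neq0).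
have ang : lagrangian_angle L o (fun p => theta p.2).
  by move=> p b pL; exact: (dz_tangent_basis lambda_neq0 C_neq0 w_smooth w_neq0 w_ode pL).
have mc p : points L p ->
    is_mean_curvature L p ((alpha / C)%:C *: normal_part L p (pos L p)).
  by move=> pL; exact: (position_is_mean_curvature lambda_neq0 C_neq0 I_open w_smooth w_neq0 w_ode theta_ode pL).
split=> //; first by exists o.
- move=> p pL; exists ((alpha / C)%:C *: normal_part L p (pos L p)).
  by split; [exact: mc|rewrite scalerA -rmorphM mulrCA divff // mulr1].
- by split=> aC; exists (alpha / C).
move=> alpha0.
have theta_cst s t : I s -> I t -> theta s = theta t.
  apply: (angle_derive0_cst I_interval) => u Iu.
  by have := theta_ode u Iu; rewrite alpha0 mul0r.
split=> //; last first.
  move=> p pL; have := mc p pL.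
  by rewrite alpha0 mul0r scale0r.
split=> //; exists o.
have [[s0 Is0]|noI] := pselect (exists s, I s); last first.
  exists 0; split=> // p b pL; case: noI; exists p.2; exact: (proj1 (pointsP pL)).
exists (angle_repr (theta s0)); split=> // p b pL bT.
by rewrite ang // (theta_cst p.2 s0 (proj1 (pointsP pL)) Is0).
Qed.
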